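(* It is provable in $\mathbf{ZF}$ that $\mathbf{IQDI}$ implies the following: (i) A topological space $\mathbf{X}$ admits an infinite locally finite cellular family if and only if it admits a denumerable locally finite cellular family of regular open sets. (ii) Every topological space admitting an infinite locally finite family of open sets admits a denumerable locally finite cellular family. (iii) Every topological space which is not lightly compact admits a denumerable locally finite cellular family.
   Context: The base theory is $\mathbf{ZF}$, with no form of the axiom of choice assumed. A set is infinite if it is not equipotent with any $n\in\omega$, and denumerable if it is equipotent with $\omega$. $\mathbf{IQDI}$: for every infinite set $X$, the set $[X]^{<\omega}$ of all finite subsets of $X$ has a denumerable subset. A family of subsets of a space is locally finite if every point has a neighborhood meeting only finitely many members of the family. A cellular family is a set of pairwise disjoint non-empty open subsets of the space. A set $U$ is regular open if $U=int(\overline{U})$. A space is lightly compact if every locally finite family of open subsets of it is finite. *)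

(* Defs.v *)
From Stdlib Require Import List.
Import ListNotations.

(** * First-order logic with equality, in the language {∈} *)

(** De Bruijn syntax. The language has no function symbols, so that terms are
    variables and substitutions are renamings. *)
Inductive form : Type :=
| Bot : form
| Mem : nat -> nat -> form
| Eql : nat -> nat -> form
| Imp : form -> form -> form
| All : form -> form.

Definition scons {A : Type} (a : A) (r : nat -> A) (n : nat) : A :=
  match n with 0 => a | S m => r m end.

Fixpoint ren (r : nat -> nat) (p : form) : form :=
  match p with
  | Bot => Bot
  | Mem x y => Mem (r x) (r y)
  | Eql x y => Eql (r x) (r y)
  | Imp p q => Imp (ren r p) (ren r q)
  | All p => All (ren (scons 0 (fun n => S (r n))) p)
  end.

Definition shift : form -> form := ren S.

(** [subst0 x p] replaces variable 0 by [x], as when removing a quantifier. *)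
Definition subst0 (x : nat) : form -> form := ren (scons x (fun n => n)).

(** Classical natural deduction. *)
Inductive derives : list form -> form -> Prop :=
| d_hyp G p : In p G -> derives G p
| d_impI G p q : derives (p :: G) q -> derives G (Imp p q)
| d_impE G p q : derives G (Imp p q) -> derives G p -> derives G q
| d_raa G p : derives (Imp p Bot :: G) Bot -> derives G p
| d_allI G p : derives (map shift G) p -> derives G (All p)
| d_allE G p x : derives G (All p) -> derives G (subst0 x p)
| d_refl G x : derives G (Eql x x)
| d_eql G p x y :
    derives G (Eql x y) -> derives G (subst0 x p) -> derives G (subst0 y p).

Definition provable (T : form -> Prop) (p : form) : Prop :=
  exists G, Forall T G /\ derives G p.

(** [fv_bound p] exceeds all free variables of [p]. *)
Fixpoint fv_bound (p : form) : nat :=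
  match p with
  | Bot => 0
  | Mem x y | Eql x y => Nat.max (S x) (S y)
  | Imp p q => Nat.max (fv_bound p) (fv_bound q)
  | All p => Nat.pred (fv_bound p)
  end.

Definition closure (p : form) : form := Nat.iter (fv_bound p) All p.

(** * Formulas with named bound variables *)

(** An [fm] is a formula awaiting the number [d] of quantifiers it is placed
    under. A [var] is a de Bruijn level, the number of quantifiers outside its
    binder; it denotes the index [d - S x] at depth [d]. Hence a quantifier can
    be written with a Rocq function, and [φ 0] is the sentence denoted by [φ]. *)
Definition var := nat.
Definition fm := nat -> form.

Definition FBot : fm := fun _ => Bot.
Definition FMem (x y : var) : fm := fun d => Mem (d - S x) (d - S y).
Definition FEql (x y : var) : fm := fun d => Eql (d - S x) (d - S y).
Definition FImp (φ ψ : fm) : fm := fun d => Imp (φ d) (ψ d).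
Definition FAll (F : var -> fm) : fm := fun d => All (F d (S d)).

Definition FNot (φ : fm) : fm := FImp φ FBot.
Definition FAnd (φ ψ : fm) : fm := FNot (FImp φ (FNot ψ)).
Definition FOr (φ ψ : fm) : fm := FImp (FNot φ) ψ.
Definition FIff (φ ψ : fm) : fm := FAnd (FImp φ ψ) (FImp ψ φ).
Definition FEx (F : var -> fm) : fm := FNot (FAll (fun x => FNot (F x))).

Declare Scope fm_scope.
Delimit Scope fm_scope with fm.
Bind Scope fm_scope with fm.

Notation "x ∈ y" := (FMem x y) (at level 70, no associativity) : fm_scope.
Notation "x = y" := (FEql x y) : fm_scope.
Notation "¬ φ" := (FNot φ) (at level 75, right associativity) : fm_scope.
Notation "x ≠ y" := (FNot (FEql x y))
  (at level 70, no associativity) : fm_scope.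
Notation "x ∉ y" := (FNot (FMem x y))
  (at level 70, no associativity) : fm_scope.
Notation "φ ∧ ψ" := (FAnd φ ψ) (at level 80, right associativity) : fm_scope.
Notation "φ ∨ ψ" := (FOr φ ψ) (at level 85, right associativity) : fm_scope.
Notation "φ ⇔ ψ" := (FIff φ ψ) (at level 95, no associativity) : fm_scope.
Notation "φ ⇒ ψ" := (FImp φ ψ) (at level 99, right associativity) : fm_scope.
Notation "∀ x .. y , φ" := (FAll (fun x => .. (FAll (fun y => φ%fm)) ..))
  (at level 200, x binder, y binder, right associativity) : fm_scope.
Notation "∃ x .. y , φ" := (FEx (fun x => .. (FEx (fun y => φ%fm)) ..))
  (at level 200, x binder, y binder, right associativity) : fm_scope.

Local Open Scope fm_scope.

Definition FExUnique (F : var -> fm) : fm :=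
  ∃ x, F x ∧ ∀ y, F y ⇒ y = x.

Notation "∃! x , φ" := (FExUnique (fun x => φ%fm))
  (at level 200, x binder, right associativity) : fm_scope.

(** [inst p xs] is [p] with its variables 0, 1, ... replaced by the list [xs];
    the remaining free variables of [p] become parameters, free at depth 0. *)
Definition inst (p : form) (xs : list var) : fm := fun d =>
  ren (fun n => match nth_error xs n with
                | Some x => d - S x
                | None => (n - length xs) + d
                end) p.

(** * The axioms of ZF *)

Definition Sub (a b : var) : fm := ∀ x, x ∈ a ⇒ x ∈ b.
Definition IsEmpty (a : var) : fm := ∀ x, x ∉ a.
(** [c] = {[a], [b]}. *)
Definition IsUPair (c a b : var) : fm := ∀ x, x ∈ c ⇔ (x = a ∨ x = b).
(** [u] is the union of the members of [a]. *)
Definition IsUnion (u a : var) : fm := ∀ x, x ∈ u ⇔ ∃ y, y ∈ a ∧ x ∈ y.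
(** [b] = [a] ∪ {[a]}. *)
Definition IsSucc (b a : var) : fm := ∀ x, x ∈ b ⇔ (x ∈ a ∨ x = a).
Definition IsInductive (w : var) : fm :=
  (∃ e, IsEmpty e ∧ e ∈ w) ∧ ∀ n, n ∈ w ⇒ ∃ m, IsSucc m n ∧ m ∈ w.

Definition Extensionality : fm := ∀ a b, (∀ x, x ∈ a ⇔ x ∈ b) ⇒ a = b.
Definition Foundation : fm :=
  ∀ a, (∃ x, x ∈ a) ⇒ ∃ x, x ∈ a ∧ ¬ ∃ y, y ∈ x ∧ y ∈ a.
Definition Pairing : fm := ∀ a b, ∃ c, IsUPair c a b.
Definition Union : fm := ∀ a, ∃ u, IsUnion u a.
Definition PowerSet : fm := ∀ a, ∃ p, ∀ x, x ∈ p ⇔ Sub x a.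
Definition Infinity : fm := ∃ w, IsInductive w.
Definition Separation (p : form) : fm :=
  ∀ a, ∃ b, ∀ x, x ∈ b ⇔ (x ∈ a ∧ inst p [x]).
Definition Replacement (p : form) : fm :=
  ∀ a, (∀ x, x ∈ a ⇒ ∃! y, inst p [x; y]) ⇒
       ∃ b, ∀ x, x ∈ a ⇒ ∃ y, y ∈ b ∧ inst p [x; y].

Inductive ZF : form -> Prop :=
| ZF_extensionality : ZF (Extensionality 0)
| ZF_foundation : ZF (Foundation 0)
| ZF_pairing : ZF (Pairing 0)
| ZF_union : ZF (Union 0)
| ZF_powerset : ZF (PowerSet 0)
| ZF_infinity : ZF (Infinity 0)
| ZF_separation p : ZF (closure (Separation p 0))
| ZF_replacement p : ZF (closure (Replacement p 0)).

(** [φ] is expected to denote a sentence. *)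
Definition ZF_proves (φ : fm) : Prop := provable ZF (φ 0).

(** * Finite, infinite and denumerable sets *)

(** [p] is the Kuratowski pair {{[x]}, {[x], [y]}}. *)
Definition IsPair (p x y : var) : fm :=
  ∀ z, z ∈ p ⇔ (IsUPair z x x ∨ IsUPair z x y).
Definition PairIn (x y f : var) : fm := ∃ p, IsPair p x y ∧ p ∈ f.

Definition IsFunction (f a b : var) : fm :=
  (∀ p, p ∈ f ⇒ ∃ x y, x ∈ a ∧ y ∈ b ∧ IsPair p x y) ∧
  (∀ x, x ∈ a ⇒ ∃! y, PairIn x y f).
Definition IsBijection (f a b : var) : fm :=
  IsFunction f a b ∧ (∀ y, y ∈ b ⇒ ∃! x, PairIn x y f).
Definition Equipotent (a b : var) : fm := ∃ f, IsBijection f a b.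

Definition IsOmega (w : var) : fm :=
  IsInductive w ∧ ∀ v, IsInductive v ⇒ Sub w v.
Definition Finite (a : var) : fm :=
  ∃ w n, IsOmega w ∧ n ∈ w ∧ Equipotent a n.
Definition Infinite (a : var) : fm := ¬ Finite a.
Definition Denumerable (a : var) : fm := ∃ w, IsOmega w ∧ Equipotent a w.

Definition IsFinSubsets (F X : var) : fm := ∀ a, a ∈ F ⇔ (Sub a X ∧ Finite a).

Definition IQDI : fm :=
  ∀ X, Infinite X ⇒
       ∃ F, IsFinSubsets F X ∧ ∃ D, Sub D F ∧ Denumerable D.

(** * Topological spaces *)

(** [T] is a topology on [X], that is, ([X], [T]) is a topological space. *)
Definition Topology (X T : var) : fm :=
  (∀ U, U ∈ T ⇒ Sub U X) ∧
  (∀ e, IsEmpty e ⇒ e ∈ T) ∧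
  X ∈ T ∧
  (∀ U V W, U ∈ T ⇒ V ∈ T ⇒ (∀ x, x ∈ W ⇔ (x ∈ U ∧ x ∈ V)) ⇒ W ∈ T) ∧
  (∀ G W, Sub G T ⇒ IsUnion W G ⇒ W ∈ T).

Definition Closed (X T C : var) : fm :=
  Sub C X ∧ ∃ U, U ∈ T ∧ ∀ x, x ∈ U ⇔ (x ∈ X ∧ x ∉ C).
Definition IsClosure (X T K A : var) : fm :=
  ∀ x, x ∈ K ⇔ (x ∈ X ∧ ∀ C, Closed X T C ⇒ Sub A C ⇒ x ∈ C).
Definition IsInterior (T I A : var) : fm :=
  ∀ x, x ∈ I ⇔ ∃ U, U ∈ T ∧ Sub U A ∧ x ∈ U.
Definition RegularOpen (X T U : var) : fm :=
  Sub U X ∧ ∃ K, IsClosure X T K U ∧ IsInterior T U K.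

Definition Neighborhood (X T N x : var) : fm :=
  Sub N X ∧ ∃ U, U ∈ T ∧ x ∈ U ∧ Sub U N.
Definition Meets (A B : var) : fm := ∃ x, x ∈ A ∧ x ∈ B.

Definition LocallyFinite (X T F : var) : fm :=
  (∀ A, A ∈ F ⇒ Sub A X) ∧
  ∀ x, x ∈ X ⇒ ∃ N, Neighborhood X T N x ∧
    ∃ G, (∀ A, A ∈ G ⇔ (A ∈ F ∧ Meets A N)) ∧ Finite G.

Definition Cellular (T F : var) : fm :=
  Sub F T ∧
  (∀ A, A ∈ F ⇒ ¬ IsEmpty A) ∧
  (∀ A B, A ∈ F ⇒ B ∈ F ⇒ A ≠ B ⇒ ¬ Meets A B).

Definition LightlyCompact (X T : var) : fm :=
  ∀ F, Sub F T ⇒ LocallyFinite X T F ⇒ Finite F.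

(* Main.v *)
From Stdlib Require Import List Arith Lia Cantor Classical ClassicalEpsilon.
From Stdlib Require Import FunctionalExtensionality PropExtensionality Eqdep_dec.
Require Import Defs.

(** By completeness of the deduction system it is enough to argue in an arbitrary
    model of ZF, whose sets are closed under comprehension for definable predicates only.

    IQDI yields a sequence of distinct finite sets [s_0], [s_1], ... of members of the
    given infinite locally finite family of open sets. Let [U_n] be the union of the
    members that occur in [s_n] but in no earlier [s_i]. Each point has a neighborhood
    meeting only finitely many [U_n], and infinitely many [U_n] are non-empty: otherwise
    all [s_n] would be subsets of one finite set. The open sets [V_n], consisting of the
    points of [U_n] outside the closure of the union of all later [U_m], are pairwise
    disjoint. If an open set meets some but only finitely many [U_n], then it meets
    [V_m] for the last such [m]; so infinitely many [V_n] are non-empty. The interiors of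
    the closures of these are regular open, still pairwise disjoint and locally finite.
    They are indexed by an infinite set of natural numbers, which is denumerable without
    any choice. *)

Class membership (M : Type) := mem : M -> M -> Prop.

(** * Completeness of the deduction system *)

Definition up (r : nat -> nat) : nat -> nat := scons 0 (fun n => S (r n)).

Lemma ren_ext_bound (p : form) : forall r s,
  (forall n, n < fv_bound p -> r n = s n) -> ren r p = ren s p.
Proof.
  induction p as [|x y|x y|p IHp q IHq|p IH]; simpl; intros r s H; try reflexivity;
    f_equal; try (apply H; lia).
  - apply IHp; intros; apply H; lia.
  - apply IHq; intros; apply H; lia.
  - apply IH. intros [|n] Hn; simpl; auto. f_equal. apply H. lia.
Qed.

Lemma ren_ext (p : form) (r s : nat -> nat) :
  (forall n, r n = s n) -> ren r p = ren s p.
Proof. intros; apply ren_ext_bound; auto. Qed.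

Lemma ren_ren (p : form) : forall r s, ren r (ren s p) = ren (fun n => r (s n)) p.
Proof.
  induction p as [|x y|x y|p IHp q IHq|p IH]; simpl; intros r s; try reflexivity; f_equal; auto.
  rewrite IH. apply ren_ext. intros [|n]; reflexivity.
Qed.

Lemma ren_id (p : form) : ren (fun n => n) p = p.
Proof.
  induction p as [|x y|x y|p IHp q IHq|p IH]; simpl; try reflexivity; f_equal; auto.
  rewrite <- IH at 2. apply ren_ext. intros [|n]; reflexivity.
Qed.

Lemma ren_subst0 (r : nat -> nat) (x : nat) (p : form) :
  ren r (subst0 x p) = subst0 (r x) (ren (up r) p).
Proof. unfold subst0. rewrite !ren_ren. apply ren_ext. intros [|n]; reflexivity. Qed.

Lemma subst0_up (r : nat -> nat) (x : nat) (p : form) :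
  subst0 x (ren (up r) p) = ren (scons x r) p.
Proof. unfold subst0. rewrite !ren_ren. apply ren_ext. intros [|n]; reflexivity. Qed.

Lemma derives_ren (G : list form) (p : form) :
  derives G p -> forall r, derives (map (ren r) G) (ren r p).
Proof.
  induction 1 as [G p H|G p q _ IH|G p q _ IH1 _ IH2|G p _ IH|G p _ IH|G p x _ IH|G x
                 |G p x y _ IH1 _ IH2]; intro r.
  - apply d_hyp, in_map, H.
  - apply d_impI, (IH r).
  - exact (d_impE _ _ _ (IH1 r) (IH2 r)).
  - apply d_raa, (IH r).
  - simpl. apply d_allI. specialize (IH (up r)). rewrite map_map in *.
    erewrite map_ext; [exact IH|]. intro q. unfold shift. rewrite !ren_ren. reflexivity.
  - rewrite ren_subst0. apply d_allE, (IH r).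
  - apply d_refl.
  - rewrite ren_subst0. apply d_eql with (r x); [exact (IH1 r)|].
    rewrite <- ren_subst0. exact (IH2 r).
Qed.

Lemma derives_weaken (G : list form) (p : form) :
  derives G p -> forall G', incl G G' -> derives G' p.
Proof.
  induction 1 as [G p H|G p q _ IH|G p q _ IH1 _ IH2|G p _ IH|G p _ IH|G p x _ IH|G x
                 |G p x y _ IH1 _ IH2]; intros G' I.
  - apply d_hyp, I, H.
  - apply d_impI, IH. apply incl_cons; [left; auto|apply incl_tl, I].
  - exact (d_impE _ _ _ (IH1 _ I) (IH2 _ I)).
  - apply d_raa, IH. apply incl_cons; [left; auto|apply incl_tl, I].
  - apply d_allI, IH, incl_map, I.
  - apply d_allE, (IH _ I).
  - apply d_refl.
  - exact (d_eql _ _ _ _ (IH1 _ I) (IH2 _ I)).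
Qed.

(** The renaming sends the fresh variable [x] to 0 and shifts all others. *)
Lemma derives_fresh (G : list form) (p : form) (x : nat) :
  Forall (fun q => fv_bound q <= x) G -> fv_bound p <= S x ->
  derives G (subst0 x p) -> derives G (All p).
Proof.
  intros HG Hp H. apply d_allI.
  set (r := fun n => if Nat.eqb n x then 0 else S n).
  assert (E1 : map (ren r) G = map shift G).
  { apply map_ext_in. intros q Hq. rewrite Forall_forall in HG. specialize (HG q Hq).
    apply ren_ext_bound. intros n Hn. unfold r.
    destruct (Nat.eqb_spec n x); [lia|reflexivity]. }
  assert (E2 : ren r (subst0 x p) = p).
  { unfold subst0. rewrite ren_ren. rewrite <- (ren_id p) at 2.
    apply ren_ext_bound. intros [|n] Hn; simpl; unfold r.
    - now rewrite Nat.eqb_refl.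
    - destruct (Nat.eqb_spec n x); [lia|reflexivity]. }
  rewrite <- E1. rewrite <- E2 at 1. now apply derives_ren.
Qed.

(** * Provability and consistency of arbitrary theories *)

Definition consistent (T : form -> Prop) : Prop := ~ provable T Bot.

Definition add (T : form -> Prop) (p : form) : form -> Prop := fun q => T q \/ q = p.

Lemma provable_hyp (T : form -> Prop) (p : form) : T p -> provable T p.
Proof. intro H. exists (p :: nil). split; [auto|apply d_hyp; now left]. Qed.

Lemma provable_mono (T T' : form -> Prop) (p : form) :
  (forall q, T q -> T' q) -> provable T p -> provable T' p.
Proof. intros I (G & HG & H). exists G. split; auto. eapply Forall_impl; eauto. Qed.

Lemma provable_lift1 (T : form -> Prop) (p q : form) :
  (forall G, derives G p -> derives G q) -> provable T p -> provable T q.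
Proof. intros I (G & HG & H). exists G. auto. Qed.

Lemma provable_lift2 (T : form -> Prop) (p q r : form) :
  (forall G, derives G p -> derives G q -> derives G r) ->
  provable T p -> provable T q -> provable T r.
Proof.
  intros I (G & HG & H) (G' & HG' & H'). exists (G ++ G'). split.
  - now apply Forall_app.
  - apply I; eapply derives_weaken; eauto; intros ? ?; apply in_or_app; auto.
Qed.

(** Deduction theorem: a derivation uses a finite list of hypotheses, in which all occurrences of
    [p] can be gathered into one at the head. *)
Lemma provable_impI (T : form -> Prop) (p q : form) :
  provable (add T p) q -> provable T (Imp p q).
Proof.
  intros (G & HG & H).
  assert (S : exists G', Forall T G' /\ incl G (p :: G')).
  { clear H. induction HG as [|a G [Ha|Ha] _ (G' & H1 & H2)].
    - exists nil. split; [constructor|intros ? []].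
    - exists (a :: G'). split; [now constructor|].
      intros b [->|Hb]; [|destruct (H2 b Hb)]; simpl; auto.
    - exists G'. split; auto. intros b [->|Hb]; [now left|auto]. }
  destruct S as (G' & H1 & H2). exists G'. split; auto.
  apply d_impI. eapply derives_weaken; eauto.
Qed.

(** Compactness: the finitely many hypotheses of a refutation already lie in a single stage of the
    increasing chain. *)
Lemma consistent_union (C : nat -> form -> Prop) :
  (forall n p, C n p -> C (S n) p) -> (forall n, consistent (C n)) ->
  consistent (fun p => exists n, C n p).
Proof.
  intros Hmon Hc (G & HG & H).
  assert (Hle : forall n m p, n <= m -> C n p -> C m p).
  { intros n m p L. induction L; auto. }
  assert (K : exists n, Forall (C n) G).
  { clear H. induction HG as [|a G (n & Ha) _ (m & IH)].
    - now exists 0.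
    - exists (Nat.max n m). constructor.
      + eapply Hle; [|eassumption]. lia.
      + eapply Forall_impl; [|eassumption]. intros q. apply Hle. lia. }
  destruct K as (n & K). apply (Hc n). exists G; auto.
Qed.

Fixpoint encode (p : form) : nat :=
  match p with
  | Bot => to_nat (0, 0)
  | Mem x y => to_nat (1, to_nat (x, y))
  | Eql x y => to_nat (2, to_nat (x, y))
  | Imp p q => to_nat (3, to_nat (encode p, encode q))
  | All p => to_nat (4, encode p)
  end.

Lemma to_nat_inj (a b c d : nat) : to_nat (a, b) = to_nat (c, d) -> a = c /\ b = d.
Proof.
  intro H. apply (f_equal of_nat) in H. rewrite !cancel_of_to in H. now inversion H.
Qed.

Lemma encode_inj (p : form) : forall q, encode p = encode q -> p = q.
Proof.
  induction p as [|x y|x y|p IHp p' IHp'|p IH]; intros [|x' y'|x' y'|q q'|q]; cbn [encode];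
    intro H; apply to_nat_inj in H; destruct H as [H1 H]; try discriminate H1; auto;
    try (apply to_nat_inj in H; destruct H as [Ha Hb]); f_equal; auto.
Qed.

(** A left inverse of [encode], with arbitrary values at numbers that code no formula. The epsilon
    operator belongs to the metatheory and adds nothing to the calculus. *)
Definition enum (n : nat) : form := epsilon (inhabits Bot) (fun p => encode p = n).

Lemma enum_encode (p : form) : enum (encode p) = p.
Proof.
  apply encode_inj.
  exact (epsilon_spec (inhabits Bot) (fun q => encode q = encode p) (ex_intro _ p eq_refl)).
Qed.

(** * Henkin axioms, maximal consistent extension and term model *)

Section Henkin.

Variable T : form -> Prop.
Hypothesis T_closed : forall p, T p -> fv_bound p = 0.
Hypothesis T_consistent : consistent T.

Definition fresh (L : list form) : nat := list_max (map fv_bound L).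

Lemma fresh_spec (L : list form) : Forall (fun q => fv_bound q <= fresh L) L.
Proof.
  apply Forall_map with (P := fun n => n <= fresh L), list_max_le. reflexivity.
Qed.

(** Henkin axioms in dual form: if the [n]-th formula fails for some object, it fails for a variable
    that is fresh for it and for the earlier axioms. Variables can play the role of new constants
    because [T] consists of sentences. *)
Fixpoint witnesses (n : nat) : list form :=
  match n with
  | 0 => nil
  | S n => let L := witnesses n in
           Imp (subst0 (fresh (enum n :: L)) (enum n)) (All (enum n)) :: L
  end.

Definition henkin_stage (n : nat) : form -> Prop := fun p => T p \/ In p (witnesses n).

(** If the new axiom [p(x)] implies [All p] were refutable, the earlier stage would prove both
    [p(x)] and the negation of [All p]; since [x] is fresh, generalizing [p(x)] gives a
    contradiction. *)
Lemma henkin_stage_consistent (n : nat) : consistent (henkin_stage n).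
Proof.
  induction n as [|n IH]; intro H.
  - apply T_consistent. revert H. apply provable_mono. intros q [?|[]]; auto.
  - apply IH. set (x := fresh (enum n :: witnesses n)) in *.
    set (p := enum n) in *. cbn [witnesses] in H.
    assert (K : provable (henkin_stage n) (Imp (Imp (subst0 x p) (All p)) Bot)).
    { apply provable_impI. revert H. apply provable_mono.
      intros q [Hq|[Hq|Hq]]; [left; now left|right; now symmetry|left; now right]. }
    destruct K as (G & HG & K). exists G. split; auto.
    pose proof (fresh_spec (p :: witnesses n)) as Hx. fold x in Hx.
    inversion Hx as [|? ? Hp HL]; subst.
    assert (HGx : Forall (fun q => fv_bound q <= x) G).
    { eapply Forall_impl; [|exact HG]. intros q [Hq|Hq].
      - rewrite (T_closed q Hq). lia.
      - rewrite Forall_forall in HL. now apply HL. }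
    eapply d_impE; [exact K|]. apply d_impI.
    eapply derives_weaken; [|intros ? ?; right; eassumption].
    apply derives_fresh with x; [exact HGx|lia|].
    apply d_raa. eapply d_impE.
    + eapply derives_weaken; [exact K|intros ? ?; now right].
    + apply d_impI, d_raa. eapply d_impE; apply d_hyp; simpl; auto.
Qed.

Definition henkin : form -> Prop := fun p => exists n, henkin_stage n p.

(** Stages are predicates rather than computed lists, because consistency is undecidable: formula
    [n] joins exactly when it is consistent with what precedes. *)
Fixpoint lindenbaum (n : nat) : form -> Prop :=
  match n with
  | 0 => henkin
  | S n => fun p =>
      lindenbaum n p \/ (p = enum n /\ consistent (add (lindenbaum n) p))
  end.

Definition maximal : form -> Prop := fun p => exists n, lindenbaum n p.

Lemma maximal_consistent : consistent maximal.
Proof.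
  apply consistent_union; [simpl; auto|].
  induction n as [|n IH]; simpl.
  - apply consistent_union.
    + intros n p [H|H]; [now left|right; now right].
    + exact henkin_stage_consistent.
  - destruct (classic (consistent (add (lindenbaum n) (enum n)))) as [H|H]; intro K.
    + apply H. revert K. apply provable_mono.
      intros q [Hq|[Hq _]]; [now left|now right].
    + apply IH. revert K. apply provable_mono.
      intros q [Hq|[-> Hq]]; tauto.
Qed.

Lemma maximal_or (p : form) : maximal p \/ provable maximal (Imp p Bot).
Proof.
  destruct (classic (consistent (add (lindenbaum (encode p)) p))) as [H|H].
  - left. exists (S (encode p)). right. now rewrite enum_encode.
  - right. apply provable_impI. apply NNPP in H. revert H. apply provable_mono.
    intros q [Hq| ->]; [left|now right]. now exists (encode p).
Qed.

Lemma maximal_closed (p : form) : provable maximal p -> maximal p.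
Proof.
  intro H. destruct (maximal_or p) as [K|K]; auto. exfalso. apply maximal_consistent.
  revert K H. apply provable_lift2. intro G. apply d_impE.
Qed.

Lemma maximal_Bot : ~ maximal Bot.
Proof. intro H. apply maximal_consistent, provable_hyp, H. Qed.

Lemma maximal_Imp (p q : form) : maximal (Imp p q) <-> (maximal p -> maximal q).
Proof.
  split.
  - intros H%provable_hyp K%provable_hyp. apply maximal_closed. revert H K.
    apply provable_lift2. intro G. apply d_impE.
  - intro H. apply maximal_closed. destruct (maximal_or p) as [K|K].
    + generalize (provable_hyp _ _ (H K)). apply provable_lift1. intros G D.
      apply d_impI. eapply derives_weaken; [exact D|intros ? ?; now right].
    + revert K. apply provable_lift1. intros G D. apply d_impI, d_raa.
      eapply d_impE.
      * eapply derives_weaken; [exact D|intros ? ?; simpl; auto].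
      * apply d_hyp. simpl. auto.
Qed.

Lemma maximal_All (p : form) : maximal (All p) <-> forall x, maximal (subst0 x p).
Proof.
  split.
  - intros H%provable_hyp x. apply maximal_closed. revert H. apply provable_lift1.
    intro G. apply d_allE.
  (* The Henkin axiom for [p] enters at the stage numbered by the code of [p], and its witness is
     the instance to which the hypothesis is applied. *)
  - intro H. set (n := encode p). set (x := fresh (enum n :: witnesses n)).
    assert (W : maximal (Imp (subst0 x p) (All p))).
    { exists 0, (S n). right. left. fold x. unfold n. now rewrite enum_encode. }
    exact (proj1 (maximal_Imp _ _) W (H x)).
Qed.

Lemma maximal_refl (x : nat) : maximal (Eql x x).
Proof. apply maximal_closed. exists nil. split; [constructor|apply d_refl]. Qed.

Lemma maximal_subst (x y : nat) (p : form) :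
  maximal (Eql x y) -> maximal (subst0 x p) -> maximal (subst0 y p).
Proof.
  intros H%provable_hyp K%provable_hyp. apply maximal_closed. revert H K.
  apply provable_lift2. intro G. apply d_eql.
Qed.

Lemma maximal_sym (x y : nat) : maximal (Eql x y) -> maximal (Eql y x).
Proof.
  (* In [Eql 0 (S x)] only the left side is substituted: the index [S x] becomes [x] once variable 0
     is removed. *)
  intro H. apply (maximal_subst x y (Eql 0 (S x)) H). apply maximal_refl.
Qed.

Lemma maximal_trans (x y z : nat) :
  maximal (Eql x y) -> maximal (Eql y z) -> maximal (Eql x z).
Proof. intros H K. exact (maximal_subst y z (Eql (S x) 0) K H). Qed.

Definition rep (x : nat) : nat := epsilon (inhabits 0) (fun y => maximal (Eql x y)).

Lemma rep_spec (x : nat) : maximal (Eql x (rep x)).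
Proof.
  exact (epsilon_spec (inhabits 0) (fun y => maximal (Eql x y))
           (ex_intro _ x (maximal_refl x))).
Qed.

(** Provably equal variables have extensionally equal classes, hence equal predicates, and epsilon
    picks the same representative from both. Thus the quotient is realized as a subtype of [nat]. *)
Lemma rep_eq (x y : nat) : rep x = rep y <-> maximal (Eql x y).
Proof.
  split; intro H.
  - eapply maximal_trans; [apply rep_spec|]. rewrite H. apply maximal_sym, rep_spec.
  - unfold rep. f_equal. apply functional_extensionality. intro z.
    apply propositional_extensionality.
    split; apply maximal_trans; auto using maximal_sym.
Qed.

Definition term_model : Set := {x : nat | rep x = x}.

Definition point (x : nat) : term_model :=
  exist _ (rep x) (proj2 (rep_eq (rep x) x) (maximal_sym _ _ (rep_spec x))).

Lemma point_eq (x y : nat) : point x = point y <-> maximal (Eql x y).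
Proof.
  rewrite <- rep_eq. split; intro H.
  - exact (f_equal (@proj1_sig _ _) H).
  - apply eq_sig_hprop; [|exact H]. intros. apply UIP_nat.
Qed.

Lemma point_surj (a : term_model) : exists x, a = point x.
Proof.
  destruct a as [x H]. exists x. apply eq_sig_hprop; [intros; apply UIP_nat|].
  now symmetry.
Qed.

#[global] Instance term_mem : membership term_model :=
  fun a b => maximal (Mem (proj1_sig a) (proj1_sig b)).

Lemma term_mem_point (x y : nat) : mem (point x) (point y) <-> maximal (Mem x y).
Proof.
  unfold mem, term_mem. cbn [point proj1_sig].
  pose proof (rep_spec x) as Hx. pose proof (rep_spec y) as Hy.
  split; intro H.
  - apply (maximal_subst (rep x) x (Mem 0 (S y))); [now apply maximal_sym|].
    apply (maximal_subst (rep y) y (Mem (S (rep x)) 0)); [now apply maximal_sym|exact H].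
  - apply (maximal_subst x (rep x) (Mem 0 (S (rep y)))); [easy|].
    apply (maximal_subst y (rep y) (Mem (S x) 0)); [easy|exact H].
Qed.

End Henkin.

(** * Satisfaction and the completeness theorem *)

Fixpoint sat {M : Type} {E : membership M} (e : nat -> M) (p : form) : Prop :=
  match p with
  | Bot => False
  | Mem x y => mem (e x) (e y)
  | Eql x y => e x = e y
  | Imp p q => sat e p -> sat e q
  | All p => forall a, sat (scons a e) p
  end.

Lemma sat_ext_bound {M : Type} {E : membership M} (p : form) : forall e e',
  (forall n, n < fv_bound p -> e n = e' n) -> sat e p <-> sat e' p.
Proof.
  induction p as [|x y|x y|p IHp q IHq|p IH]; simpl; intros e e' H.
  - tauto.
  - rewrite !H by lia. tauto.
  - rewrite !H by lia. tauto.
  - rewrite (IHp e e'), (IHq e e'); [tauto|intros; apply H; lia..].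
  - assert (K : forall a, sat (scons a e) p <-> sat (scons a e') p).
    { intro a. apply IH. intros [|n] Hn; simpl; auto. apply H. lia. }
    split; intros S a; apply K, S.
Qed.

Lemma sat_ext {M : Type} {E : membership M} (p : form) (e e' : nat -> M) :
  (forall n, e n = e' n) -> sat e p <-> sat e' p.
Proof. intro; apply sat_ext_bound; auto. Qed.

Lemma sat_ren {M : Type} {E : membership M} (p : form) : forall r e,
  sat e (ren r p) <-> sat (fun n => e (r n)) p.
Proof.
  induction p as [|x y|x y|p IHp q IHq|p IH]; simpl; intros r e; try tauto.
  - rewrite IHp, IHq. tauto.
  - assert (K : forall a, sat (scons a e) (ren (scons 0 (fun n => S (r n))) p) <->
                          sat (scons a (fun n => e (r n))) p).
    { intro a. rewrite IH. apply sat_ext. intros [|n]; reflexivity. }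
    split; intros S a; apply K, S.
Qed.

(** The truth lemma, by induction on the formula. It is stated for all renamings [r] because the
    quantifier case passes from [r] to [scons x r]; surjectivity of [point] reduces quantification
    over the model to quantification over variables. *)
Lemma term_model_sat (T : form -> Prop)
    (T_closed : forall p, T p -> fv_bound p = 0) (T_consistent : consistent T) (p : form) :
  forall r, sat (fun n => point T T_closed T_consistent (r n)) p <->
            maximal T (ren r p).
Proof.
  induction p as [|x y|x y|p IHp q IHq|p IH]; intro r; cbn [sat ren].
  - pose proof (maximal_Bot T T_closed T_consistent). tauto.
  - apply term_mem_point.
  - apply point_eq.
  - rewrite IHp, IHq. symmetry. now apply maximal_Imp.
  - rewrite (maximal_All T T_closed T_consistent).
    assert (K : forall x, sat
        (scons (point T T_closed T_consistent x)
           (fun n => point T T_closed T_consistent (r n))) p <->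
        maximal T (subst0 x (ren (up r) p))).
    { intro x. rewrite subst0_up, <- IH. apply sat_ext. intros [|n]; reflexivity. }
    split; intro H.
    + intro x. apply K, H.
    + intro a. destruct (point_surj T T_closed T_consistent a) as [x ->]. apply K, H.
Qed.

(** If [T] with the negation of [p] is consistent, its term model satisfies [T] but not [p];
    otherwise the deduction theorem and reductio give a proof. The term model is a subtype of [nat],
    so models in [Set] suffice. *)
Theorem completeness (T : form -> Prop) (p : form) :
  (forall q, T q -> fv_bound q = 0) -> fv_bound p = 0 ->
  (forall (M : Set) (E : membership M),
     (forall q e, T q -> sat e q) -> forall e, sat e p) ->
  provable T p.
Proof.
  intros HT Hp H. set (T' := add T (Imp p Bot)).
  destruct (classic (consistent T')) as [C|C].
  - exfalso.
    assert (HT' : forall q, T' q -> fv_bound q = 0).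
    { intros q [Hq| ->]; auto. simpl. now rewrite Hp. }
    assert (S : forall q (e : nat -> term_model T'), T' q -> sat e q).
    { intros q e Hq.
      apply (sat_ext_bound q (fun n => point T' HT' C n)).
      - rewrite (HT' q Hq). intros; lia.
      - apply (term_model_sat T' HT' C q (fun n => n)). rewrite ren_id.
        exists 0, 0. now left. }
    apply (S (Imp p Bot) (fun n => point T' HT' C n)); [now right|].
    apply H. intros q e Hq. apply S. now left.
  - apply NNPP in C. apply provable_impI in C. revert C. apply provable_lift1.
    intros G K. apply d_raa. eapply d_impE.
    + eapply derives_weaken; [exact K|intros ? ?; now right].
    + apply d_hyp. now left.
Qed.

Lemma fv_bound_closure (p : form) : fv_bound (closure p) = 0.
Proof.
  assert (K : forall k, fv_bound (Nat.iter k All p) = fv_bound p - k).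
  { induction k as [|k IH]; simpl; [|rewrite IH]; lia. }
  unfold closure. rewrite K. lia.
Qed.

Lemma sat_closure {M : Type} {E : membership M} (p : form) :
  (forall e, sat e (closure p)) -> forall e, sat e p.
Proof.
  unfold closure. induction (fv_bound p) as [|k IH]; simpl; auto.
  intros H. apply IH. intro e.
  apply (sat_ext _ (scons (e 0) (fun n => e (S n)))); [now intros [|n]|].
  apply H.
Qed.

Local Infix "∈" := mem (at level 70, no associativity).

(** * Semantic counterparts of the formulas *)

Section Semantics.

Context {M : Set} {E : membership M}.

Definition sub (a b : M) : Prop := forall x, x ∈ a -> x ∈ b.
Definition is_empty (a : M) : Prop := forall x, ~ x ∈ a.
Definition is_upair (c a b : M) : Prop := forall x, x ∈ c <-> x = a \/ x = b.
Definition is_union (u a : M) : Prop := forall x, x ∈ u <-> exists y, y ∈ a /\ x ∈ y.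
Definition is_succ (b a : M) : Prop := forall x, x ∈ b <-> x ∈ a \/ x = a.
Definition inductive (w : M) : Prop :=
  (exists e, is_empty e /\ e ∈ w) /\ forall n, n ∈ w -> exists m, is_succ m n /\ m ∈ w.
Definition is_pair (p x y : M) : Prop :=
  forall z, z ∈ p <-> is_upair z x x \/ is_upair z x y.
Definition pair_in (x y f : M) : Prop := exists p, is_pair p x y /\ p ∈ f.
Definition is_function (f a b : M) : Prop :=
  (forall p, p ∈ f -> exists x y, x ∈ a /\ y ∈ b /\ is_pair p x y) /\
  (forall x, x ∈ a -> exists y, pair_in x y f /\ forall y', pair_in x y' f -> y' = y).
Definition is_bijection (f a b : M) : Prop :=
  is_function f a b /\
  (forall y, y ∈ b -> exists x, pair_in x y f /\ forall x', pair_in x' y f -> x' = x).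
Definition equipotent (a b : M) : Prop := exists f, is_bijection f a b.
Definition is_omega (w : M) : Prop := inductive w /\ forall v, inductive v -> sub w v.
Definition finite (a : M) : Prop := exists w n, is_omega w /\ n ∈ w /\ equipotent a n.
Definition denumerable (a : M) : Prop := exists w, is_omega w /\ equipotent a w.
Definition is_fin_subsets (F X : M) : Prop := forall a, a ∈ F <-> sub a X /\ finite a.
Definition iqdi : Prop :=
  forall X, ~ finite X ->
    exists F, is_fin_subsets F X /\ exists D, sub D F /\ denumerable D.

Definition topology (X T : M) : Prop :=
  (forall U, U ∈ T -> sub U X) /\
  (forall e, is_empty e -> e ∈ T) /\
  X ∈ T /\
  (forall U V W, U ∈ T -> V ∈ T -> (forall x, x ∈ W <-> x ∈ U /\ x ∈ V) -> W ∈ T) /\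
  (forall G W, sub G T -> is_union W G -> W ∈ T).
Definition closed (X T C : M) : Prop :=
  sub C X /\ exists U, U ∈ T /\ forall x, x ∈ U <-> x ∈ X /\ ~ x ∈ C.
Definition is_closure (X T K A : M) : Prop :=
  forall x, x ∈ K <-> x ∈ X /\ forall C, closed X T C -> sub A C -> x ∈ C.
Definition is_interior (T I A : M) : Prop :=
  forall x, x ∈ I <-> exists U, U ∈ T /\ sub U A /\ x ∈ U.
Definition regular_open (X T U : M) : Prop :=
  sub U X /\ exists K, is_closure X T K U /\ is_interior T U K.
Definition neighborhood (X T N x : M) : Prop :=
  sub N X /\ exists U, U ∈ T /\ x ∈ U /\ sub U N.
Definition meets (A B : M) : Prop := exists x, x ∈ A /\ x ∈ B.
Definition locally_finite (X T F : M) : Prop :=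
  (forall A, A ∈ F -> sub A X) /\
  forall x, x ∈ X -> exists N, neighborhood X T N x /\
    exists G, (forall A, A ∈ G <-> A ∈ F /\ meets A N) /\ finite G.
Definition cellular (T F : M) : Prop :=
  sub F T /\
  (forall A, A ∈ F -> ~ is_empty A) /\
  (forall A B, A ∈ F -> B ∈ F -> A <> B -> ~ meets A B).
Definition lightly_compact (X T : M) : Prop :=
  forall F, sub F T -> locally_finite X T F -> finite F.

Lemma sat_Not (e : nat -> M) (A : fm) (P : Prop) (d : nat) :
  (sat e (A d) <-> P) -> (sat e (FNot A d) <-> ~ P).
Proof. cbn. tauto. Qed.

Lemma sat_Imp (e : nat -> M) (A B : fm) (P Q : Prop) (d : nat) :
  (sat e (A d) <-> P) -> (sat e (B d) <-> Q) ->
  (sat e (FImp A B d) <-> (P -> Q)).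
Proof. cbn. tauto. Qed.

Lemma sat_And (e : nat -> M) (A B : fm) (P Q : Prop) (d : nat) :
  (sat e (A d) <-> P) -> (sat e (B d) <-> Q) ->
  (sat e (FAnd A B d) <-> P /\ Q).
Proof. cbn. destruct (classic P), (classic Q); tauto. Qed.

Lemma sat_Or (e : nat -> M) (A B : fm) (P Q : Prop) (d : nat) :
  (sat e (A d) <-> P) -> (sat e (B d) <-> Q) ->
  (sat e (FOr A B d) <-> P \/ Q).
Proof. cbn. destruct (classic P), (classic Q); tauto. Qed.

Lemma sat_Iff (e : nat -> M) (A B : fm) (P Q : Prop) (d : nat) :
  (sat e (A d) <-> P) -> (sat e (B d) <-> Q) ->
  (sat e (FIff A B d) <-> (P <-> Q)).
Proof. cbn. destruct (classic P), (classic Q); tauto. Qed.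

Lemma sat_All (e : nat -> M) (F : var -> fm) (P : M -> Prop) (d : nat) :
  (forall a, sat (scons a e) (F d (S d)) <-> P a) ->
  (sat e (FAll F d) <-> forall a, P a).
Proof. cbn. intro H. split; intros K a; apply H, K. Qed.

Lemma sat_Ex (e : nat -> M) (F : var -> fm) (P : M -> Prop) (d : nat) :
  (forall a, sat (scons a e) (F d (S d)) <-> P a) ->
  (sat e (FEx F d) <-> exists a, P a).
Proof.
  intro H. unfold FEx.
  rewrite (sat_Not e _ (forall a, ~ P a) d).
  - split; [apply not_all_not_ex|firstorder].
  - apply sat_All. intro a. apply sat_Not, H.
Qed.

End Semantics.

Arguments iqdi M {E}.

(** Matches a named-variable formula with its semantic counterpart, connective by connective,
    unfolding defined predicates on the way. Atoms agree by computing de Bruijn indices at a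
    concrete depth; instances of schemata are left as goals. *)
Ltac read :=
  lazymatch goal with
  | |- sat _ (FNot _ _) <-> _ => apply sat_Not; read
  | |- sat _ (FImp _ _ _) <-> _ => apply sat_Imp; read
  | |- sat _ (FAnd _ _ _) <-> _ => apply sat_And; read
  | |- sat _ (FOr _ _ _) <-> _ => apply sat_Or; read
  | |- sat _ (FIff _ _ _) <-> _ => apply sat_Iff; read
  | |- sat _ (FAll _ _) <-> _ => apply sat_All; intro; cbv beta; read
  | |- sat _ (FEx _ _) <-> _ => apply sat_Ex; intro; cbv beta; read
  | |- sat _ (FMem _ _ _) <-> _ => exact (iff_refl _)
  | |- sat _ (FEql _ _ _) <-> _ => exact (iff_refl _)
  | |- sat _ (inst _ _ _) <-> _ => idtac
  | |- sat _ ?A <-> _ => let h := head_of A in unfold h; cbv beta; read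
  end
with head_of t := lazymatch t with ?f _ => head_of f | _ => t end.

(** * The statement and the axioms read in a model *)

Definition conclusion (M : Set) {E : membership M} : Prop :=
  iqdi M ->
  (forall X T : M, topology X T ->
     ((exists F, ~ finite F /\ locally_finite X T F /\ cellular T F) <->
      (exists F, denumerable F /\ locally_finite X T F /\ cellular T F /\
                 forall U, U ∈ F -> regular_open X T U))) /\
  (forall X T : M, topology X T ->
     (exists F, ~ finite F /\ locally_finite X T F /\ sub F T) ->
     exists F, denumerable F /\ locally_finite X T F /\ cellular T F) /\
  (forall X T : M, topology X T ->
     ~ lightly_compact X T ->
     exists F, denumerable F /\ locally_finite X T F /\ cellular T F).

(** Separation is stated for satisfaction under an arbitrary valuation [e], whose values act as the
    parameters of the formula. *)
Class zermelo_model (M : Set) {E : membership M} : Prop := {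
  extensionality : forall a b : M, (forall x, x ∈ a <-> x ∈ b) -> a = b;
  foundation : forall a : M, (exists x, x ∈ a) ->
    exists x, x ∈ a /\ ~ exists y, y ∈ x /\ y ∈ a;
  pairing : forall a b : M, exists c, is_upair c a b;
  union : forall a : M, exists u, is_union u a;
  power_set : forall a : M, exists p, forall x, x ∈ p <-> sub x a;
  infinity : exists w : M, inductive w;
  separation : forall p (e : nat -> M) (a : M),
    exists b, forall x, x ∈ b <-> x ∈ a /\ sat (scons x e) p }.

(** In the separation axiom [a], [b] and [x] have levels 0, 1 and 2. Variable 0 of [p] denotes [x],
    while its other variables jump over all three binders and are read in [e]. *)
Lemma sat_inst1 {M : Set} {E : membership M} (e : nat -> M) (p : form) (a b x : M) :
  sat (scons x (scons b (scons a e))) (inst p (2 :: nil) 3) <-> sat (scons x e) p.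
Proof.
  unfold inst. rewrite sat_ren. apply sat_ext. intros [|n]; [reflexivity|].
  now destruct n; cbn; rewrite ?Nat.sub_0_r, 1?Nat.add_comm.
Qed.

Lemma zermelo_model_of_sat (M : Set) {E : membership M} (m : M) :
  (forall q (e : nat -> M), ZF q -> sat e q) -> zermelo_model M.
Proof.
  intro H. split.
  - refine (proj1 (_ : _ <-> _) (H _ (fun _ => m) ZF_extensionality)). read.
  - refine (proj1 (_ : _ <-> _) (H _ (fun _ => m) ZF_foundation)). read.
  - refine (proj1 (_ : _ <-> _) (H _ (fun _ => m) ZF_pairing)). read.
  - refine (proj1 (_ : _ <-> _) (H _ (fun _ => m) ZF_union)). read.
  - refine (proj1 (_ : _ <-> _) (H _ (fun _ => m) ZF_powerset)). read.
  - refine (proj1 (_ : _ <-> _) (H _ (fun _ => m) ZF_infinity)). read.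
  - intros p e. refine (proj1 (_ : _ <-> _) (sat_closure _ (fun e' => H _ e' (ZF_separation p)) e)).
    read. apply sat_inst1.
Qed.

(** * Definability with parameters *)

Section Definability.

Context {M : Set} {E : membership M}.

Definition valuation (t : nat -> nat + M) (e : nat -> M) (n : nat) : M :=
  match t n with inl i => e i | inr a => a end.

(** [t] sends each variable of the formula [p] to an argument or to a parameter. *)
Definition definable (P : (nat -> M) -> Prop) : Prop :=
  exists p t, forall e, P e <-> sat (valuation t e) p.

(** A term is definable when its graph is: variable 0 holds the value and the arguments are shifted
    by one. *)
Definition definable_term (t : (nat -> M) -> M) : Prop :=
  definable (fun e => e 0 = t (fun n => e (S n))).

Lemma definable_iff (P Q : (nat -> M) -> Prop) :
  (forall e, P e <-> Q e) -> definable Q -> definable P.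
Proof. intros H (p & t & K). exists p, t. intro e. now rewrite H, K. Qed.

Lemma definable_False : definable (fun _ => False).
Proof. exists Bot, (fun n => inl n). reflexivity. Qed.

(** Even and odd variables separate the parameters of the two formulas. *)
Lemma definable_impl (P Q : (nat -> M) -> Prop) :
  definable P -> definable Q -> definable (fun e => P e -> Q e).
Proof.
  intros (p & t & Hp) (q & s & Hq).
  exists (Imp (ren Nat.double p) (ren (fun n => S (Nat.double n)) q)).
  exists (fun n => if Nat.even n then t (Nat.div2 n) else s (Nat.div2 n)).
  intro e. cbn. rewrite !sat_ren, Hp, Hq.
  apply Morphisms_Prop.iff_iff_iff_impl_morphism; apply sat_ext; intro n;
    unfold valuation, Nat.double.
  - replace (n + n) with (2 * n) by lia. now rewrite Nat.even_even, Nat.div2_double.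
  - replace (S (n + n)) with (2 * n + 1) by lia.
    rewrite Nat.even_odd, Nat.add_1_r, Nat.div2_succ_double. reflexivity.
Qed.

(** Variables of [p] standing for argument 0 are renamed to the bound variable 0; every other
    variable [n] moves to [S n], and its argument index drops by one. *)
Lemma definable_forall (P : (nat -> M) -> M -> Prop) :
  definable (fun e => P (fun n => e (S n)) (e 0)) -> definable (fun e => forall x, P e x).
Proof.
  intros (p & t & Hp).
  exists (All (ren (fun n => match t n with inl 0 => 0 | _ => S n end) p)).
  exists (fun n => match t n with inl (S i) => inl i | u => u end).
  intro e. cbn.
  assert (K : forall x, P e x <-> sat (valuation t (scons x e)) p)
    by (intro x; apply (Hp (scons x e))).
  assert (K' : forall x, P e x <->
    sat (scons x (valuation (fun n => match t n with inl (S i) => inl i | u => u end) e))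
      (ren (fun n => match t n with inl 0 => 0 | _ => S n end) p)).
  { intro x. rewrite K, sat_ren. apply sat_ext. intro n. unfold valuation.
    destruct (t n) as [[|i]|a] eqn:Ht; cbn; rewrite ?Ht; reflexivity. }
  split; intros H x; apply K', H.
Qed.

Lemma definable_not (P : (nat -> M) -> Prop) :
  definable P -> definable (fun e => ~ P e).
Proof. intro H. apply (definable_impl _ _ H definable_False). Qed.

Lemma definable_and (P Q : (nat -> M) -> Prop) :
  definable P -> definable Q -> definable (fun e => P e /\ Q e).
Proof.
  intros HP HQ. apply (definable_iff _ (fun e => ~ (P e -> ~ Q e))).
  - intro e. destruct (classic (P e)), (classic (Q e)); tauto.
  - auto using definable_not, definable_impl.
Qed.

Lemma definable_or (P Q : (nat -> M) -> Prop) :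
  definable P -> definable Q -> definable (fun e => P e \/ Q e).
Proof.
  intros HP HQ. apply (definable_iff _ (fun e => ~ P e -> Q e)).
  - intro e. destruct (classic (P e)), (classic (Q e)); tauto.
  - auto using definable_not, definable_impl.
Qed.

Lemma definable_equiv (P Q : (nat -> M) -> Prop) :
  definable P -> definable Q -> definable (fun e => P e <-> Q e).
Proof. intros HP HQ. apply definable_and; apply definable_impl; assumption. Qed.

Lemma definable_exists (P : (nat -> M) -> M -> Prop) :
  definable (fun e => P (fun n => e (S n)) (e 0)) -> definable (fun e => exists x, P e x).
Proof.
  intro H. apply (definable_iff _ (fun e => ~ forall x, ~ P e x)).
  - intro e. split; [firstorder|apply not_all_not_ex].
  - apply definable_not, definable_forall, definable_not, H.
Qed.

Lemma definable_ren (r : nat -> nat) (P : (nat -> M) -> Prop) :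
  definable P -> definable (fun e => P (fun n => e (r n))).
Proof.
  intros (p & t & H). exists p.
  exists (fun n => match t n with inl i => inl (r i) | u => u end).
  intro e. rewrite H. apply sat_ext. intro n. unfold valuation. now destruct (t n).
Qed.

Lemma definable_term_var (k : nat) : definable_term (fun e => e k).
Proof. exists (Eql 0 (S k)), (fun n => inl n). reflexivity. Qed.

Lemma definable_term_const (a : M) : definable_term (fun _ => a).
Proof. exists (Eql 0 1), (fun n => match n with 0 => inl 0 | _ => inr a end). reflexivity. Qed.

Lemma definable_app1 (P : M -> Prop) (t : (nat -> M) -> M) :
  definable (fun e => P (e 0)) -> definable_term t -> definable (fun e => P (t e)).
Proof.
  intros HP Ht. apply (definable_iff _ (fun e => exists x, x = t e /\ P x)).
  - intro e. split; [intro H; now exists (t e)|now intros (x & -> & H)].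
  - apply definable_exists, definable_and; [exact Ht|exact HP].
Qed.

Lemma definable_app2 (R : M -> M -> Prop) (s t : (nat -> M) -> M) :
  definable (fun e => R (e 0) (e 1)) -> definable_term s -> definable_term t ->
  definable (fun e => R (s e) (t e)).
Proof.
  intros HR Hs Ht.
  apply (definable_iff _ (fun e => exists y x, x = s e /\ y = t e /\ R x y)).
  - intro e. split; [intro H; now exists (t e), (s e)|now intros (y & x & -> & -> & H)].
  - apply definable_exists, definable_exists. cbv beta.
    apply definable_and; [|apply definable_and].
    + exact (definable_ren (fun n => match n with 0 => 0 | S n => S (S n) end) _ Hs).
    + exact (definable_ren S _ Ht).
    + exact HR.
Qed.

Lemma definable_mem (s t : (nat -> M) -> M) :
  definable_term s -> definable_term t -> definable (fun e => s e ∈ t e).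
Proof.
  apply (definable_app2 mem). exists (Mem 0 1), (fun n => inl n). reflexivity.
Qed.

Lemma definable_eq (s t : (nat -> M) -> M) :
  definable_term s -> definable_term t -> definable (fun e => s e = t e).
Proof.
  apply (definable_app2 eq). exists (Eql 0 1), (fun n => inl n). reflexivity.
Qed.

Lemma definable_term_app1 (f : M -> M) (t : (nat -> M) -> M) :
  definable (fun e => e 0 = f (e 1)) -> definable_term t ->
  definable_term (fun e => f (t e)).
Proof.
  intros Hf Ht. apply (definable_app2 (fun x y => x = f y)); [exact Hf| |].
  - exact (definable_term_var 0).
  - exact (definable_ren (fun n => match n with 0 => 0 | S n => S (S n) end) _ Ht).
Qed.

Lemma definable_term_app2 (f : M -> M -> M) (s t : (nat -> M) -> M) :
  definable (fun e => e 0 = f (e 1) (e 2)) -> definable_term s -> definable_term t ->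
  definable_term (fun e => f (s e) (t e)).
Proof.
  intros Hf Hs Ht.
  apply (definable_iff _
    (fun e => exists y x, x = s (fun n => e (S n)) /\ y = t (fun n => e (S n)) /\ e 0 = f x y)).
  - intro e. split; [intro H; now eexists _, _|now intros (y & x & -> & -> & H)].
  - apply definable_exists, definable_exists. cbv beta.
    apply definable_and; [|apply definable_and].
    (* Under the two quantifiers index 0 is [x], 1 is [y], 2 is the value of the whole term, and the
       arguments start at 3. The three renamings place each graph accordingly. *)
    + exact (definable_ren (fun n => match n with 0 => 0 | S n => S (S (S n)) end) _ Hs).
    + exact (definable_ren (fun n => match n with 0 => 1 | S n => S (S (S n)) end) _ Ht).
    + exact (definable_ren (fun n => match n with 0 => 2 | 1 => 0 | _ => 1 end) _ Hf).
Qed.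

End Definability.

Create HintDb definable_term.
(** Proves definability by following the shape of a predicate. Function symbols are resolved through
    the graphs registered in the hint database, predicate variables through hypotheses in the
    context, and set-theoretic notions by unfolding. *)
Ltac definable_step :=
  cbv beta;
  match goal with
  | |- definable_term (fun e => e ?k) => exact (definable_term_var k)
  | |- definable_term (fun _ => ?a) => exact (definable_term_const a)
  | |- definable_term (fun e => ?f (@?s e) (@?t e)) =>
      apply (definable_term_app2 f s t); [solve [auto with definable_term]| |]
  | |- definable_term (fun e => ?f (@?t e)) =>
      apply (definable_term_app1 f t); [solve [auto with definable_term]|]
  | |- definable (fun e => _ ∈ _) => simple apply definable_mem
  | |- definable (fun e => _ = _) => simple apply definable_eq
  | |- definable (fun e => ~ _) => simple apply definable_not
  | |- definable (fun e => _ /\ _) => simple apply definable_and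
  | |- definable (fun e => _ \/ _) => simple apply definable_or
  | |- definable (fun e => _ <-> _) => simple apply definable_equiv
  | |- definable (fun e => exists x, _) => simple apply definable_exists
  | |- definable (fun e => _ -> _) => simple apply definable_impl
  | |- definable (fun e => forall x, _) => simple apply definable_forall
  | H : definable (fun e => ?P (e 0)) |- definable (fun e => ?P (@?t e)) =>
      apply (definable_app1 P t H)
  | H : definable (fun e => ?R (e 0) (e 1)) |- definable (fun e => ?R (@?s e) (@?t e)) =>
      apply (definable_app2 R s t H)
  | |- definable _ => progress unfold sub, is_empty, is_upair, is_union, is_succ, inductive,
      is_pair, pair_in, is_function, is_bijection, equipotent, is_omega, finite, denumerable,
      is_fin_subsets, closed, is_closure, is_interior, meets
  end.
Ltac definability := repeat definable_step.

(** * Elementary set theory in a model *)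

(** Choice in the metatheory only gives names to objects of the model. Those named below are unique
    by extensionality, and comprehension is applied to them only through definitions of their
    graphs. *)
Definition choose {A : Type} {P : A -> Prop} (H : exists x, P x) : A :=
  proj1_sig (constructive_indefinite_description P H).

Lemma choose_spec {A : Type} {P : A -> Prop} (H : exists x, P x) : P (choose H).
Proof. exact (proj2_sig (constructive_indefinite_description P H)). Qed.

Section SetTheory.

Context {M : Set} {E : membership M} {Z : zermelo_model M}.

Lemma separate (P : M -> Prop) (a : M) :
  definable (fun e => P (e 0)) -> exists b, forall x, x ∈ b <-> x ∈ a /\ P x.
Proof.
  intros (p & t & H).
  (* The predicate depends on argument 0 alone, so all argument variables may be merged into the
     element variable 0. Parameter [n] is stored at [n] in the valuation; elsewhere [a] is a mere
     filler. *)
  destruct (separation (ren (fun n => match t n with inl _ => 0 | inr _ => S n end) p)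
              (fun n => match t n with inl _ => a | inr c => c end) a) as [b Hb].
  exists b. intro x. rewrite Hb, sat_ren, (H (fun _ => x)).
  apply and_iff_compat_l, sat_ext. intro n. unfold valuation.
  destruct (t n) as [i|c] eqn:Ht; cbn; now rewrite ?Ht.
Qed.

Definition upair (a b : M) : M := choose (pairing a b).
Definition big_union (a : M) : M := choose (union a).
Definition powerset (a : M) : M := choose (power_set a).

Lemma mem_upair (a b x : M) : x ∈ upair a b <-> x = a \/ x = b.
Proof. apply (choose_spec (pairing a b)). Qed.

Lemma mem_big_union (a x : M) : x ∈ big_union a <-> exists y, y ∈ a /\ x ∈ y.
Proof. apply (choose_spec (union a)). Qed.

Lemma mem_powerset (a x : M) : x ∈ powerset a <-> sub x a.
Proof. apply (choose_spec (power_set a)). Qed.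

Definition adj (a x : M) : M := big_union (upair a (upair x x)).

Lemma mem_adj (a x y : M) : y ∈ adj a x <-> y ∈ a \/ y = x.
Proof.
  unfold adj. rewrite mem_big_union. split.
  - intros (z & Hz & Hy). apply mem_upair in Hz as [->| ->]; [now left|].
    apply mem_upair in Hy. tauto.
  - intros [Hy| ->]; [exists a|exists (upair x x)]; rewrite !mem_upair; tauto.
Qed.

Lemma empty_exists : exists e : M, is_empty e.
Proof. destruct infinity as (w & (e & He & _) & _). now exists e. Qed.

Definition empty : M := choose empty_exists.

Lemma mem_empty (x : M) : ~ x ∈ empty.
Proof. apply (choose_spec empty_exists). Qed.

Lemma sub_antisym (a b : M) : sub a b -> sub b a -> a = b.
Proof. intros H K. apply extensionality. firstorder. Qed.

Lemma is_empty_eq (a : M) : is_empty a -> a = empty.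
Proof. intro H. apply sub_antisym; intros x Hx; [destruct (H x Hx)|destruct (mem_empty x Hx)]. Qed.

Lemma upair_definable : definable (fun e => e 0 = upair (e 1) (e 2)).
Proof.
  apply (definable_iff _ (fun e => is_upair (e 0) (e 1) (e 2))); [|definability].
  intro e. split.
  - intros -> x. apply mem_upair.
  - intro H. apply extensionality. intro x. now rewrite mem_upair.
Qed.

Lemma big_union_definable : definable (fun e => e 0 = big_union (e 1)).
Proof.
  apply (definable_iff _ (fun e => is_union (e 0) (e 1))); [|definability].
  intro e. split.
  - intros -> x. apply mem_big_union.
  - intro H. apply extensionality. intro x. now rewrite mem_big_union.
Qed.

Lemma powerset_definable : definable (fun e => e 0 = powerset (e 1)).
Proof.
  apply (definable_iff _ (fun e => forall x, x ∈ e 0 <-> sub x (e 1))); [|definability].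
  intro e. split.
  - intros -> x. apply mem_powerset.
  - intro H. apply extensionality. intro x. now rewrite mem_powerset.
Qed.

Lemma adj_definable : definable (fun e => e 0 = adj (e 1) (e 2)).
Proof.
  apply (definable_iff _ (fun e => forall x, x ∈ e 0 <-> x ∈ e 1 \/ x = e 2)); [|definability].
  intro e. split.
  - intros -> x. apply mem_adj.
  - intro H. apply extensionality. intro x. now rewrite mem_adj.
Qed.

Definition pair (x y : M) : M := upair (upair x x) (upair x y).

Lemma is_upair_iff (c a b : M) : is_upair c a b <-> c = upair a b.
Proof.
  split.
  - intro H. apply extensionality. intro x. now rewrite mem_upair.
  - intros -> x. apply mem_upair.
Qed.

Lemma is_pair_iff (p x y : M) : is_pair p x y <-> p = pair x y.
Proof.
  unfold is_pair, pair. split.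
  - intro H. apply extensionality. intro z. now rewrite H, mem_upair, !is_upair_iff.
  - intros -> z. now rewrite mem_upair, !is_upair_iff.
Qed.

Lemma pair_in_iff (x y f : M) : pair_in x y f <-> pair x y ∈ f.
Proof.
  split.
  - intros (p & Hp%is_pair_iff & H). now subst.
  - intro H. exists (pair x y). now rewrite is_pair_iff.
Qed.

Lemma upair_inj (a b c d : M) : upair a b = upair c d -> a = c /\ b = d \/ a = d /\ b = c.
Proof.
  intro H.
  assert (K : forall x, (x = a \/ x = b) <-> (x = c \/ x = d))
    by (intro x; now rewrite <- !mem_upair, H).
  pose proof (proj1 (K a) (or_introl eq_refl)). pose proof (proj1 (K b) (or_intror eq_refl)).
  pose proof (proj2 (K c) (or_introl eq_refl)). pose proof (proj2 (K d) (or_intror eq_refl)).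
  intuition congruence.
Qed.

Lemma pair_inj (x y x' y' : M) : pair x y = pair x' y' -> x = x' /\ y = y'.
Proof.
  intro H. apply upair_inj in H as [[H K]|[H K]]; apply upair_inj in H, K; intuition congruence.
Qed.

Lemma pair_definable : definable (fun e => e 0 = pair (e 1) (e 2)).
Proof.
  apply (definable_iff _ (fun e => is_pair (e 0) (e 1) (e 2))); [|definability].
  intro e. now rewrite is_pair_iff.
Qed.

End SetTheory.

#[export] Hint Resolve upair_definable big_union_definable powerset_definable adj_definable
  pair_definable : definable_term.

(** * The natural numbers of the model *)

Section Naturals.

Context {M : Set} {E : membership M} {Z : zermelo_model M}.

Definition succ (n : M) : M := adj n n.

Lemma mem_succ (n x : M) : x ∈ succ n <-> x ∈ n \/ x = n.
Proof. apply mem_adj. Qed.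

Lemma inductive_iff (w : M) :
  inductive w <-> empty ∈ w /\ forall n, n ∈ w -> succ n ∈ w.
Proof.
  split; intros [H K]; split.
  - destruct H as (e & He & H). now rewrite <- (is_empty_eq e He).
  - intros n Hn. destruct (K n Hn) as (m & Hm & Hw).
    replace (succ n) with m; [exact Hw|]. apply extensionality. intro x. now rewrite mem_succ.
  - exists empty. split; [intro; apply mem_empty|exact H].
  - intros n Hn. exists (succ n). split; [intro; apply mem_succ|now apply K].
Qed.

Lemma omega_exists : exists w : M, is_omega w.
Proof.
  destruct infinity as [w Hw].
  destruct (separate (fun n => forall v, inductive v -> n ∈ v) w) as [o Ho]; [definability|].
  exists o. split.
  - apply inductive_iff. split.
    + apply Ho. split; [now apply inductive_iff in Hw|]. intros v Hv. now apply inductive_iff in Hv.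
    + intros n [Hn Hn']%Ho. apply Ho. split.
      * apply inductive_iff in Hw. now apply Hw.
      * intros v Hv. specialize (Hn' v Hv). apply inductive_iff in Hv. now apply Hv.
  - intros v Hv n [_ Hn]%Ho. auto.
Qed.

Definition omega : M := choose omega_exists.

Lemma is_omega_iff (w : M) : is_omega w <-> w = omega.
Proof.
  pose proof (choose_spec omega_exists) as [H1 H2]. fold omega in *. split.
  - intros [K1 K2]. now apply sub_antisym; auto.
  - now intros ->.
Qed.

Lemma omega_inductive : inductive omega.
Proof. apply (choose_spec omega_exists). Qed.

Lemma empty_omega : empty ∈ omega.
Proof. apply inductive_iff, omega_inductive. Qed.

Lemma succ_omega (n : M) : n ∈ omega -> succ n ∈ omega.
Proof. revert n. apply inductive_iff, omega_inductive. Qed.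

(** Induction holds only for definable predicates, which cut out an inductive set of the model;
    [omega] may contain nonstandard elements. *)
Lemma omega_ind (P : M -> Prop) :
  definable (fun e => P (e 0)) -> P empty ->
  (forall n, n ∈ omega -> P n -> P (succ n)) -> forall n, n ∈ omega -> P n.
Proof.
  intros HP H0 HS n Hn. destruct (separate P omega HP) as [s Hs].
  apply (Hs n). apply (proj2 (choose_spec omega_exists)); [|exact Hn].
  apply inductive_iff. split.
  - apply Hs. split; [apply empty_omega|exact H0].
  - intros m [Hm Km]%Hs. apply Hs. split; [now apply succ_omega|now apply HS].
Qed.

End Naturals.

Ltac omega_induction :=
  match goal with |- forall n, n ∈ omega -> @?P n => apply (omega_ind P); cbv beta end.

(** * The order of the natural numbers *)

Section Arithmetic.

Context {M : Set} {E : membership M} {Z : zermelo_model M}.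

Lemma succ_definable : definable (fun e => e 0 = succ (e 1)).
Proof. unfold succ. definability. Qed.

Lemma omega_trans (n : M) : n ∈ omega -> sub n omega.
Proof.
  revert n. omega_induction; [definability| |].
  - intros x Hx. destruct (mem_empty x Hx).
  - intros n Hn IH x [Hx| ->]%mem_succ; auto.
Qed.

Lemma nat_trans (n m : M) : n ∈ omega -> m ∈ n -> sub m n.
Proof.
  intros Hn. revert m; revert n Hn. omega_induction; [definability| |].
  - intros x Hx. destruct (mem_empty x Hx).
  - intros n Hn IH m [Hm| ->]%mem_succ x Hx; apply mem_succ; left; [now apply (IH m)|exact Hx].
Qed.

Lemma mem_irrefl (x : M) : ~ x ∈ x.
Proof.
  intro H. destruct (foundation (upair x x)) as (y & Hy & K).
  - exists x. apply mem_upair. now left.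
  - apply K. apply mem_upair in Hy. exists x. rewrite mem_upair. destruct Hy; subst; auto.
Qed.

Lemma empty_least (n : M) : n ∈ omega -> n = empty \/ empty ∈ n.
Proof.
  revert n. omega_induction; [definability|now left|].
  intros n _ [->|H]; right; apply mem_succ; auto.
Qed.

Lemma succ_least (n m : M) : n ∈ omega -> m ∈ n -> succ m = n \/ succ m ∈ n.
Proof.
  intros Hn. revert m; revert n Hn.
  omega_induction; [pose proof succ_definable; definability| |].
  - intros x Hx. destruct (mem_empty x Hx).
  - intros n Hn IH m [Hm| ->]%mem_succ; [|now left].
    right. apply mem_succ. destruct (IH m Hm); auto.
Qed.

Lemma trichotomy (n m : M) : n ∈ omega -> m ∈ omega -> n ∈ m \/ n = m \/ m ∈ n.
Proof.
  intro Hn. revert m; revert n Hn. omega_induction; [definability| |].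
  - intros m Hm. destruct (empty_least m Hm); auto.
  - intros n Hn IH m Hm. destruct (IH m Hm) as [H|[->|H]].
    + destruct (succ_least m n Hm H); auto.
    + right. right. apply mem_succ. now right.
    + right. right. apply mem_succ. now left.
Qed.

Lemma least_exists (P : M -> Prop) (n : M) :
  definable (fun e => P (e 0)) -> n ∈ omega -> P n ->
  exists m, m ∈ omega /\ P m /\ forall k, k ∈ m -> ~ P k.
Proof.
  intros HP Hn Pn. destruct (separate P omega HP) as [s Hs].
  destruct (foundation s) as (m & Hm & K); [exists n; now apply Hs|].
  apply Hs in Hm as [Hm Pm]. exists m. repeat split; auto.
  intros k Hk Pk. apply K. exists k. split; [exact Hk|]. apply Hs. split; [|exact Pk].
  now apply (omega_trans m).
Qed.

(** Induction on the strict bound: when the bound is [succ k], either [k] itself is the greatest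
    solution or [k] is already a bound. *)
Lemma greatest_exists (P : M -> Prop) (k : M) :
  definable (fun e => P (e 0)) -> k ∈ omega ->
  (exists n, n ∈ omega /\ P n) -> (forall n, n ∈ omega -> P n -> n ∈ k) ->
  exists m, m ∈ omega /\ P m /\ forall n, n ∈ omega -> P n -> n ∈ m \/ n = m.
Proof.
  intros HP Hk (n0 & Hn0 & P0). revert k Hk. omega_induction; [definability| |].
  - intro H. destruct (mem_empty _ (H _ Hn0 P0)).
  - intros k Hk IH H. destruct (classic (P k)) as [Pk|Pk].
    + exists k. repeat split; auto. intros n Hn Pn. apply mem_succ. auto.
    + apply IH. intros n Hn Pn. destruct (proj1 (mem_succ _ _) (H n Hn Pn)) as [K| ->]; tauto.
Qed.

Lemma succ_inj (n m : M) : n ∈ omega -> m ∈ omega -> succ n = succ m -> n = m.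
Proof.
  intros Hn Hm H.
  assert (K1 : n ∈ succ m) by (rewrite <- H; apply mem_succ; now right).
  assert (K2 : m ∈ succ n) by (rewrite H; apply mem_succ; now right).
  apply mem_succ in K1 as [K1|K1]; auto. apply mem_succ in K2 as [K2|K2]; auto.
  destruct (mem_irrefl n). now apply (nat_trans n m).
Qed.

Lemma succ_nonempty (n : M) : succ n <> empty.
Proof. intro H. apply (mem_empty n). rewrite <- H. apply mem_succ. now right. Qed.

End Arithmetic.

#[export] Hint Resolve succ_definable : definable_term.

(** * Equipotence and finiteness *)

Section Finiteness.

Context {M : Set} {E : membership M} {Z : zermelo_model M}.

(** A bijection presented as a relation of the metatheory whose behaviour outside [a] and [b] is
    free. The field [corr_iff] combines single-valuedness and injectivity. *)
Record correspondence (R : M -> M -> Prop) (a b : M) : Prop := {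
  corr_total : forall x, x ∈ a -> exists y, y ∈ b /\ R x y;
  corr_onto : forall y, y ∈ b -> exists x, x ∈ a /\ R x y;
  corr_iff : forall x x' y y', x ∈ a -> x' ∈ a -> y ∈ b -> y' ∈ b ->
    R x y -> R x' y' -> (x = x' <-> y = y') }.

Lemma relation_set (R : M -> M -> Prop) (a b : M) :
  definable (fun e => R (e 0) (e 1)) ->
  exists f, forall p, p ∈ f <-> exists x y, x ∈ a /\ y ∈ b /\ p = pair x y /\ R x y.
Proof.
  intro HR.
  destruct (separate (fun p => exists x y, x ∈ a /\ y ∈ b /\ p = pair x y /\ R x y)
    (* Kuratowski pairs with coordinates in [a] and [b] are sets of subsets of their union, which
       bounds the relation for separation. *)
    (powerset (powerset (big_union (upair a b))))) as [f Hf]; [definability|].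
  exists f. intro p. rewrite Hf. split; [tauto|]. intro H. split; [|exact H].
  destruct H as (x & y & Hx & Hy & -> & _).
  assert (K : forall z, z = x \/ z = y -> z ∈ big_union (upair a b)).
  { intros z [->| ->]; apply mem_big_union; [exists a|exists b]; rewrite mem_upair; auto. }
  apply mem_powerset. intros q Hq. apply mem_powerset. intros z Hz. apply K.
  apply mem_upair in Hq as [->| ->]; apply mem_upair in Hz; tauto.
Qed.

Lemma equipotent_iff (a b : M) :
  equipotent a b <->
  exists R, definable (fun e => R (e 0) (e 1)) /\ correspondence R a b.
Proof.
  split.
  - intros (f & [H1 H2] & H3). exists (fun x y => pair x y ∈ f). split; [definability|].
    assert (K : forall x y, pair x y ∈ f -> x ∈ a /\ y ∈ b).
    { intros x y H. destruct (H1 _ H) as (x' & y' & Hx & Hy & Hp%is_pair_iff).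
      apply pair_inj in Hp as [-> ->]. auto. }
    split.
    + intros x Hx. destruct (H2 x Hx) as (y & Hy%pair_in_iff & _). exists y. firstorder.
    + intros y Hy. destruct (H3 y Hy) as (x & Hx%pair_in_iff & _). exists x. firstorder.
    + intros x x' y y' Hx Hx' Hy Hy' P P'. split; intro Q; subst.
      * destruct (H2 x' Hx) as (z & _ & U).
        rewrite (U y), (U y'); rewrite ?pair_in_iff; auto.
      * destruct (H3 y' Hy) as (z & _ & U).
        rewrite (U x), (U x'); rewrite ?pair_in_iff; auto.
  - intros (R & HR & [H1 H2 H3]). destruct (relation_set R a b HR) as [f Hf].
    assert (K : forall x y, pair x y ∈ f <-> x ∈ a /\ y ∈ b /\ R x y).
    { intros x y. rewrite Hf. split.
      - intros (x' & y' & Hx & Hy & Hp & r). apply pair_inj in Hp as [-> ->]. auto.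
      - intros (Hx & Hy & r). now exists x, y. }
    exists f. split; [split|].
    + intros p Hp. apply Hf in Hp as (x & y & Hx & Hy & -> & r).
      exists x, y. rewrite is_pair_iff. auto.
    + intros x Hx. destruct (H1 x Hx) as (y & Hy & r). exists y.
      rewrite pair_in_iff, K. split; [auto|]. intros y' Hy'. rewrite pair_in_iff, K in Hy'.
      symmetry. apply (H3 x x y y'); tauto.
    + intros y Hy. destruct (H2 y Hy) as (x & Hx & r). exists x.
      rewrite pair_in_iff, K. split; [auto|]. intros x' Hx'. rewrite pair_in_iff, K in Hx'.
      symmetry. apply (H3 x x' y y); tauto.
Qed.

Lemma equipotent_sym (a b : M) : equipotent a b -> equipotent b a.
Proof.
  rewrite !equipotent_iff. intros (R & HR & [H1 H2 H3]). exists (fun x y => R y x).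
  split; [definability|]. split; auto.
  intros x x' y y' Hx Hx' Hy Hy' r r'. symmetry. now apply H3.
Qed.

Lemma equipotent_trans (a b c : M) : equipotent a b -> equipotent b c -> equipotent a c.
Proof.
  rewrite !equipotent_iff. intros (R & HR & [H1 H2 H3]) (S & HS & [K1 K2 K3]).
  exists (fun x z => exists y, y ∈ b /\ R x y /\ S y z). split; [definability|]. split.
  - intros x Hx. destruct (H1 x Hx) as (y & Hy & r). destruct (K1 y Hy) as (z & Hz & s).
    exists z. eauto.
  - intros z Hz. destruct (K2 z Hz) as (y & Hy & s). destruct (H2 y Hy) as (x & Hx & r).
    exists x. eauto.
  - intros x x' z z' Hx Hx' Hz Hz' (y & Hy & r & s) (y' & Hy' & r' & s').
    rewrite (H3 x x' y y'); auto.
Qed.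

Lemma equipotent_refl (a : M) : equipotent a a.
Proof.
  apply equipotent_iff. exists eq. split; [definability|]. split; eauto.
  intros; subst; tauto.
Qed.

(** * Finite sets and their closure properties *)

Lemma finite_iff (a : M) : finite a <-> exists n, n ∈ omega /\ equipotent a n.
Proof.
  split.
  - intros (w & n & ->%is_omega_iff & H). eauto.
  - intros (n & H). exists omega, n. now rewrite is_omega_iff.
Qed.

Lemma denumerable_iff (a : M) : denumerable a <-> equipotent a omega.
Proof.
  split.
  - intros (w & ->%is_omega_iff & H). exact H.
  - intro H. exists omega. now rewrite is_omega_iff.
Qed.

Lemma finite_equipotent (a b : M) : equipotent a b -> finite a -> finite b.
Proof.
  rewrite !finite_iff. intros H (n & Hn & K). exists n.
  eauto using equipotent_sym, equipotent_trans.
Qed.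

Lemma finite_nat (n : M) : n ∈ omega -> finite n.
Proof. intro H. apply finite_iff. eauto using equipotent_refl. Qed.

Lemma finite_empty : finite empty.
Proof. apply finite_nat, empty_omega. Qed.

Lemma adj_absorb (a x : M) : x ∈ a -> adj a x = a.
Proof. intro H. apply extensionality. intro y. rewrite mem_adj. intuition congruence. Qed.

Lemma finite_adj (a x : M) : finite a -> finite (adj a x).
Proof.
  intro H. destruct (classic (x ∈ a)) as [Hx|Hx]; [now rewrite adj_absorb|].
  apply finite_iff in H as (n & Hn & (R & HR & [H1 H2 H3])%equipotent_iff).
  apply finite_iff. exists (succ n). split; [now apply succ_omega|].
  apply equipotent_iff. pose proof (mem_irrefl n) as Hi.
  exists (fun y m => y ∈ a /\ m ∈ n /\ R y m \/ y = x /\ m = n).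
  split; [definability|]. split.
  - intros y [Hy| ->]%mem_adj.
    + destruct (H1 y Hy) as (m & Hm & r). exists m. rewrite mem_succ. auto.
    + exists n. rewrite mem_succ. auto.
  - intros m [Hm| ->]%mem_succ.
    + destruct (H2 m Hm) as (y & Hy & r). exists y. rewrite mem_adj. auto.
    + exists x. rewrite mem_adj. auto.
  - intros y y' m m' _ _ _ _ [(Hy & Hm & r)|[-> ->]] [(Hy' & Hm' & r')|[-> ->]].
    + now apply H3.
    + split; intros ->; contradiction.
    + split; intros <-; contradiction.
    + tauto.
Qed.

Lemma remove_exists (a x : M) : exists b, forall y, y ∈ b <-> y ∈ a /\ y <> x.
Proof. apply separate. definability. Qed.

Lemma adj_remove (a b x : M) :
  x ∈ a -> (forall y, y ∈ b <-> y ∈ a /\ y <> x) -> a = adj b x.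
Proof.
  intros Hx Hb. apply extensionality. intro y. rewrite mem_adj, Hb.
  destruct (classic (y = x)) as [->|]; tauto.
Qed.

(** Induction on the number equipotent to the set, for all sets of that size at once: the element
    matched with the last number [n] is removed and put back by adjunction. *)
Lemma finite_ind (P : M -> Prop) :
  definable (fun e => P (e 0)) -> P empty -> (forall a x, P a -> P (adj a x)) ->
  forall a, finite a -> P a.
Proof.
  intros HP H0 HS a (n & Hn & H)%finite_iff. revert a H. revert n Hn.
  omega_induction; [definability| |].
  - intros a (R & _ & [H1 _ _])%equipotent_iff. rewrite (is_empty_eq a); [exact H0|].
    intros x Hx. destruct (H1 x Hx) as (y & Hy & _). now apply mem_empty in Hy.
  - intros n Hn IH a (R & HR & [H1 H2 H3])%equipotent_iff.
    assert (Hsn : n ∈ succ n) by (apply mem_succ; auto).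
    destruct (H2 n Hsn) as (x & Hx & r). destruct (remove_exists a x) as [b Hb].
    rewrite (adj_remove a b x Hx Hb). apply HS, IH, equipotent_iff. exists R. split; [exact HR|].
    split.
    + intros y [Hy Hyx]%Hb. destruct (H1 y Hy) as (m & [Hm| ->]%mem_succ & r'); [eauto|].
      destruct Hyx. now apply (H3 y x n n).
    + intros m Hm. destruct (H2 m) as (y & Hy & r'); [apply mem_succ; auto|].
      exists y. split; [|exact r']. apply Hb. split; [exact Hy|]. intros ->.
      apply (mem_irrefl n). replace n with m at 1; [exact Hm|].
      apply (H3 x x m n); auto. apply mem_succ; auto.
    + intros y y' m m' [Hy _]%Hb [Hy' _]%Hb Hm Hm'. apply H3; auto; apply mem_succ; auto.
Qed.

Ltac finite_induction :=
  match goal with |- forall a, finite a -> @?P a => apply (finite_ind P); cbv beta end.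

Lemma finite_sub (a b : M) : finite a -> sub b a -> finite b.
Proof.
  intro Ha. revert b. revert a Ha. finite_induction; [definability| |].
  - intros b Hb. rewrite (is_empty_eq b); [apply finite_empty|].
    intros x Hx. exact (mem_empty x (Hb x Hx)).
  - intros a x IH b Hb. destruct (classic (x ∈ b)) as [Hx|Hx].
    + destruct (remove_exists b x) as [c Hc]. rewrite (adj_remove b c x Hx Hc).
      apply finite_adj, IH. intros y [Hy Hyx]%Hc. apply Hb, mem_adj in Hy. tauto.
    + apply IH. intros y Hy. destruct (proj1 (mem_adj _ _ _) (Hb y Hy)); congruence.
Qed.

(** Here [R] may be a partial function. Adjoining [x] to the domain contributes at most one new
    value. *)
Lemma finite_image (R : M -> M -> Prop) (a b : M) :
  definable (fun e => R (e 0) (e 1)) -> finite a ->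
  (forall x y y', R x y -> R x y' -> y = y') ->
  (forall y, y ∈ b -> exists x, x ∈ a /\ R x y) -> finite b.
Proof.
  intros HR Ha HF. revert b. revert a Ha. finite_induction; [definability| |].
  - intros b Hb. rewrite (is_empty_eq b); [apply finite_empty|].
    intros y Hy. destruct (Hb y Hy) as (x & Hx & _). exact (mem_empty x Hx).
  - intros a x IH b Hb.
    destruct (separate (fun y => exists z, z ∈ a /\ R z y) b) as [c Hc]; [definability|].
    assert (Fc : finite c) by (apply IH; intros y Hy; now apply Hc in Hy).
    destruct (classic (exists y, y ∈ b /\ R x y)) as [(y & Hy & r)|N].
    + apply (finite_sub (adj c y)); [now apply finite_adj|].
      intros z Hz. apply mem_adj. destruct (Hb z Hz) as (x' & [Hx'| ->]%mem_adj & r').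
      * left. apply Hc. eauto.
      * right. eapply HF; eauto.
    + apply (finite_sub c); [exact Fc|]. intros z Hz. apply Hc. split; [exact Hz|].
      destruct (Hb z Hz) as (x' & [Hx'| ->]%mem_adj & r'); [eauto|]. destruct N; eauto.
Qed.

Lemma finite_union (a b c : M) :
  finite a -> finite b -> (forall x, x ∈ c -> x ∈ a \/ x ∈ b) -> finite c.
Proof.
  intros Ha Hb. revert c. revert b Hb. finite_induction; [definability| |].
  - intros c Hc. apply (finite_sub a); [exact Ha|]. intros x Hx.
    destruct (Hc x Hx) as [|K]; [assumption|]. now apply mem_empty in K.
  - intros b x IH c Hc. destruct (remove_exists c x) as [d Hd].
    apply (finite_sub (adj d x)).
    + apply finite_adj, IH. intros y [Hy Hyx]%Hd.
      destruct (Hc y Hy) as [|[|]%mem_adj]; tauto.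
    + intros y Hy. apply mem_adj. rewrite Hd. destruct (classic (y = x)); tauto.
Qed.

(** Subsets of [adj a x] either are subsets of [a] or arise from one by adjoining [x]; the latter
    form a finite image. *)
Lemma finite_powerset (a : M) : finite a -> finite (powerset a).
Proof.
  revert a. finite_induction; [definability| |].
  - apply (finite_sub (adj empty empty)); [apply finite_adj, finite_empty|].
    intros x Hx%mem_powerset. apply mem_adj. right. apply is_empty_eq.
    intros y Hy. exact (mem_empty y (Hx y Hy)).
  - intros a x IH.
    destruct (separate (fun s => x ∈ s) (powerset (adj a x))) as [b Hb]; [definability|].
    apply (finite_union (powerset a) b); [exact IH| |].
    + apply (finite_image (fun s t => t = adj s x) (powerset a)); [definability|exact IH| |].
      * congruence.
      * intros s [Hs%mem_powerset Hx]%Hb. destruct (remove_exists s x) as [t Ht].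
        exists t. split; [|now apply adj_remove]. apply mem_powerset.
        intros y [Hy Hyx]%Ht. apply Hs, mem_adj in Hy. tauto.
    + intros s Hs. rewrite Hb. destruct (classic (x ∈ s)) as [Hx|Hx]; [now right|left].
      apply mem_powerset in Hs. apply mem_powerset. intros y Hy.
      destruct (proj1 (mem_adj _ _ _) (Hs y Hy)); congruence.
Qed.

Lemma finite_bounded (a : M) :
  finite a -> sub a omega -> exists k, k ∈ omega /\ sub a k.
Proof.
  revert a. finite_induction; [definability| |].
  - intros _. exists empty. split; [apply empty_omega|now intro].
  - intros a x IH H. destruct IH as (k & Hk & K).
    { intros y Hy. apply H, mem_adj. auto. }
    assert (Hx : x ∈ omega) by (apply H, mem_adj; auto).
    destruct (trichotomy x k Hx Hk) as [L|L].
    + exists k. split; [exact Hk|]. intros y [Hy| ->]%mem_adj; auto.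
    + exists (succ x). split; [now apply succ_omega|].
      intros y [Hy| ->]%mem_adj; apply mem_succ; [left|now right].
      destruct L as [->|L]; [now apply K|]. apply (nat_trans x k); auto.
Qed.

Lemma omega_infinite : ~ finite omega.
Proof.
  intro H. destruct (finite_bounded omega H) as (k & Hk & K); [now intro|].
  exact (mem_irrefl k (K k Hk)).
Qed.

Lemma denumerable_infinite (a : M) : denumerable a -> ~ finite a.
Proof.
  intros H%denumerable_iff F. apply omega_infinite. exact (finite_equipotent _ _ H F).
Qed.

(** Induction on [n] adds one covering set at a time, so the bare existence of each finite cover is
    enough and no choice is made inside the model. *)
Lemma finite_bounded_union (Q : M -> M -> Prop) (n : M) :
  definable (fun e => Q (e 0) (e 1)) ->
  (forall i, i ∈ omega -> exists c, finite c /\ forall x, Q i x -> x ∈ c) -> n ∈ omega ->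
  exists c, finite c /\ forall i x, i ∈ n -> Q i x -> x ∈ c.
Proof.
  intros HQ H. revert n. omega_induction; [definability| |].
  - exists empty. split; [apply finite_empty|]. intros i x Hi. now apply mem_empty in Hi.
  - intros n Hn (c & Fc & Hc). destruct (H n Hn) as (d & Fd & Hd).
    exists (big_union (upair c d)). split.
    + apply (finite_union c d); auto. intros x (y & [->| ->]%mem_upair & Hx)%mem_big_union; auto.
    + intros i x [Hi| ->]%mem_succ Hq; apply mem_big_union;
        [exists c|exists d]; rewrite mem_upair; eauto.
Qed.

(** * Unbounded sets of natural numbers *)

Section Enumeration.

Variable B : M.
Hypothesis B_omega : sub B omega.
Hypothesis B_unbounded : forall k, k ∈ omega -> exists n, n ∈ B /\ k ∈ n.

Definition first (b : M) : Prop := b ∈ B /\ forall c, c ∈ b -> ~ c ∈ B.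
Definition next (b c : M) : Prop := c ∈ B /\ b ∈ c /\ forall d, d ∈ B -> b ∈ d -> ~ d ∈ c.

Lemma next_exists (b : M) : b ∈ omega -> exists c, next b c.
Proof.
  intro Hb. destruct (B_unbounded b Hb) as (n & Hn & Hbn).
  destruct (least_exists (fun c => c ∈ B /\ b ∈ c) n) as (c & _ & [Hc Hbc] & L);
    [definability|auto|auto|].
  exists c. repeat split; auto. intros d Hd Hbd Hdc. now apply (L d).
Qed.

(** The least relation with [first b -> enumerates b 0] and
    [enumerates b n -> next b c -> enumerates c (n + 1)]: the [n]-th element of [B] is [b]. *)
Definition enumerates (b n : M) : Prop :=
  forall R, (forall b, first b -> pair b empty ∈ R) ->
    (forall b n c, pair b n ∈ R -> next b c -> pair c (succ n) ∈ R) -> pair b n ∈ R.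

Lemma enumerates_definable : definable (fun e => enumerates (e 0) (e 1)).
Proof. unfold enumerates, first, next. definability. Qed.

Lemma enumerates_first (b : M) : first b -> enumerates b empty.
Proof. intros H R R0 _. now apply R0. Qed.

Lemma enumerates_next (b n c : M) : enumerates b n -> next b c -> enumerates c (succ n).
Proof. intros H K R R0 RS. eapply RS; eauto. Qed.

(** The pairs with the claimed property form a set [R] closed under both generating rules, so the
    least relation lies within it. Keeping [enumerates b n] inside [Q] makes the predecessor an
    enumerated one. *)
Lemma enumerates_inv (b n : M) :
  enumerates b n -> b ∈ B /\ n ∈ omega /\
  (first b /\ n = empty \/
   exists c m, enumerates c m /\ m ∈ omega /\ c ∈ B /\ next c b /\ n = succ m).
Proof.
  pose proof enumerates_definable as HD.
  set (Q := fun b n => enumerates b n /\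
    (first b /\ n = empty \/
     exists c m, enumerates c m /\ m ∈ omega /\ c ∈ B /\ next c b /\ n = succ m)).
  destruct (relation_set Q B omega) as [R HR]; [unfold Q, first, next; definability|].
  assert (K : forall b n, pair b n ∈ R <-> b ∈ B /\ n ∈ omega /\ Q b n).
  { intros b' n'. rewrite HR. split.
    - intros (x & y & Hx & Hy & Hp & q). apply pair_inj in Hp as [-> ->]. auto.
    - intros (Hx & Hy & q). now exists b', n'. }
  intro H. enough (L : b ∈ B /\ n ∈ omega /\ Q b n) by (unfold Q in L; tauto).
  apply K, H.
  - intros b' Hb'. apply K. split; [apply Hb'|]. split; [apply empty_omega|].
    split; [now apply enumerates_first|]. now left.
  - intros b' n' c (Hb & Hn & q & _)%K Hc. apply K. split; [apply Hc|].
    split; [now apply succ_omega|]. split; [now apply (enumerates_next b')|].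
    right. now exists b', n'.
Qed.

Lemma first_unique (b c : M) : first b -> first c -> b = c.
Proof.
  intros [Hb Kb] [Hc Kc].
  destruct (trichotomy b c) as [H|[H|H]]; auto; exfalso; [now apply (Kc b)|now apply (Kb c)].
Qed.

Lemma next_unique (b c d : M) : next b c -> next b d -> c = d.
Proof.
  intros (Hc & Hbc & Kc) (Hd & Hbd & Kd).
  destruct (trichotomy c d) as [H|[H|H]]; auto; exfalso; [now apply (Kd c)|now apply (Kc d)].
Qed.

Lemma prev_unique (b c d : M) : b ∈ B -> c ∈ B -> next b d -> next c d -> b = c.
Proof.
  intros Hb Hc (_ & Hbd & Kb) (_ & Hcd & Kc).
  destruct (trichotomy b c) as [H|[H|H]]; auto; exfalso; [now apply (Kb c)|now apply (Kc b)].
Qed.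

Lemma enumerates_functional (n b c : M) :
  n ∈ omega -> enumerates b n -> enumerates c n -> b = c.
Proof.
  pose proof enumerates_definable as HD.
  intro Hn. revert b c. revert n Hn. omega_induction; [definability| |].
  - intros b c (_ & _ & [[Hb _]|(? & m & _ & _ & _ & _ & K)])%enumerates_inv
      (_ & _ & [[Hc _]|(? & m' & _ & _ & _ & _ & K')])%enumerates_inv;
      try (now destruct (succ_nonempty m)); try (now destruct (succ_nonempty m')).
    now apply first_unique.
  - intros n Hn IH b c (_ & _ & [[_ K]|(b' & m & Eb & Hm & _ & Nb & K)])%enumerates_inv
      (_ & _ & [[_ K']|(c' & m' & Ec & Hm' & _ & Nc & K')])%enumerates_inv;
      try (now destruct (succ_nonempty n)).
    apply succ_inj in K; auto. apply succ_inj in K'; auto. subst m m'.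
    rewrite (IH b' c') in Nb; auto. now apply (next_unique c').
Qed.

Lemma enumerates_injective (n m b : M) :
  n ∈ omega -> enumerates b n -> enumerates b m -> n = m.
Proof.
  pose proof enumerates_definable as HD.
  assert (FN : forall b c, c ∈ B -> next c b -> ~ first b).
  { intros b' c Hc (_ & Hcb & _) [_ K]. now apply (K c). }
  intro Hn. revert m b. revert n Hn. omega_induction; [definability| |].
  - intros m b (_ & _ & [[Hb _]|(? & m' & _ & _ & _ & _ & K)])%enumerates_inv
      (_ & _ & [[_ K']|(c & ? & _ & _ & Hc & Nc & _)])%enumerates_inv; auto;
      try (now destruct (succ_nonempty m')). now destruct (FN b c).
  - intros n Hn IH m b (_ & _ & [[_ K]|(b' & m' & Eb & Hm & Hb' & Nb & K)])%enumerates_inv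
      (_ & _ & [[Fb _]|(c & k & Ec & Hk & Hc & Nc & K')])%enumerates_inv;
      try (now destruct (succ_nonempty n)); [now destruct (FN b b')|].
    apply succ_inj in K; auto. subst m' m. f_equal.
    rewrite (prev_unique b' c b) in Eb; auto. now apply (IH k c).
Qed.

Lemma enumerates_onto (n : M) : n ∈ omega -> exists b, b ∈ B /\ enumerates b n.
Proof.
  pose proof enumerates_definable as HD.
  revert n. omega_induction; [definability| |].
  - destruct (B_unbounded empty empty_omega) as (n & Hn & _).
    destruct (least_exists (fun b => b ∈ B) n) as (b & _ & Hb & L); [definability|auto|auto|].
    exists b. split; [exact Hb|]. now apply enumerates_first.
  - intros n Hn (b & Hb & Eb). destruct (next_exists b) as [c Hc]; [auto|].
    exists c. split; [apply Hc|]. now apply (enumerates_next b).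
Qed.

(** A least unenumerated element of [B] is not the first one; the greatest element of [B] below it
    is enumerated, and its successor in [B] is the supposed counterexample. *)
Lemma enumerates_total (b : M) : b ∈ B -> exists n, n ∈ omega /\ enumerates b n.
Proof.
  pose proof enumerates_definable as HD.
  intro Hb. apply NNPP. intro H.
  destruct (least_exists (fun b => b ∈ B /\ ~ exists n, n ∈ omega /\ enumerates b n) b)
    as (c & Hc & [HcB N] & L); [definability|auto|auto|].
  destruct (classic (first c)) as [F|F].
  - apply N. exists empty. split; [apply empty_omega|now apply enumerates_first].
  - destruct (greatest_exists (fun d => d ∈ B /\ d ∈ c) c) as (d & _ & [Hd Hdc] & G);
      [definability|auto| |tauto|].
    + apply NNPP. intro K. apply F. split; [exact HcB|]. intros d Hd Hd'. apply K. exists d. auto.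
    + assert (ND : next d c).
      { repeat split; auto. intros d' Hd' Hdd' Hd'c.
        destruct (G d') as [K| ->]; auto.
        - apply (mem_irrefl d). now apply (nat_trans d d'); auto.
        - exact (mem_irrefl d Hdd'). }
      apply (L d Hdc). split; [exact Hd|]. intros (n & Hn & En). apply N.
      exists (succ n). split; [now apply succ_omega|now apply (enumerates_next d)].
Qed.

Lemma unbounded_denumerable : denumerable B.
Proof.
  apply denumerable_iff, equipotent_iff. exists enumerates.
  split; [apply enumerates_definable|]. split.
  - apply enumerates_total.
  - apply enumerates_onto.
  - intros b c n m _ _ Hn Hm Eb Ec. split; intros ->.
    + now apply (enumerates_injective n m c).
    + now apply (enumerates_functional m b c).
Qed.

End Enumeration.
End Finiteness.

(** * Locally finite families of open sets *)

Section Topology.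

Context {M : Set} {E : membership M} {Z : zermelo_model M}.
Variables X T : M.
Hypothesis top : topology X T.

Lemma open_sub (O : M) : O ∈ T -> sub O X.
Proof. apply top. Qed.

Lemma open_inter (U V : M) :
  U ∈ T -> V ∈ T -> exists W, W ∈ T /\ forall x, x ∈ W <-> x ∈ U /\ x ∈ V.
Proof.
  intros HU HV. destruct (separate (fun x => x ∈ V) U) as [W HW]; [definability|].
  exists W. split; [|exact HW]. now apply (proj1 (proj2 (proj2 (proj2 top))) U V W).
Qed.

Lemma open_union (P : M -> Prop) :
  definable (fun e => P (e 0)) ->
  exists W, W ∈ T /\ forall x, x ∈ W <-> exists O, O ∈ T /\ P O /\ x ∈ O.
Proof.
  intro HP. destruct (separate P T HP) as [G HG].
  exists (big_union G). split.
  - apply (proj2 (proj2 (proj2 (proj2 top))) G).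
    + intros O HO. now apply HG in HO.
    + intro x. apply mem_big_union.
  - intro x. rewrite mem_big_union. split; intros (O & H).
    + rewrite HG in H. exists O. tauto.
    + exists O. rewrite HG. tauto.
Qed.

(** If [O] missed [V], the complement of [O] would be a closed set containing [V], hence also its
    closure [K]. *)
Lemma closure_meets (K V O : M) :
  sub V X -> is_closure X T K V -> O ∈ T -> meets O K -> meets O V.
Proof.
  intros HV HK HO (x & HxO & Hx). apply NNPP. intro N.
  destruct (separate (fun x => ~ x ∈ O) X) as [C HC]; [definability|].
  apply HK in Hx as [_ Hx]. assert (x ∈ C) as K'; [|apply HC in K'; tauto].
  apply Hx.
  - split; [intros y Hy; now apply HC in Hy|]. exists O. split; [exact HO|].
    intro y. rewrite HC. pose proof (open_sub O HO y). destruct (classic (y ∈ O)); tauto.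
  - intros y Hy. apply HC. split; [now apply HV|]. intro Hy'. apply N. now exists y.
Qed.

Lemma regularization (V : M) :
  V ∈ T -> exists R K, is_closure X T K V /\ is_interior T R K /\
    R ∈ T /\ regular_open X T R /\ sub V R /\ (forall O, O ∈ T -> meets O R -> meets O V).
Proof.
  intro HV.
  destruct (separate (fun x => forall C, closed X T C -> sub V C -> x ∈ C) X) as [K HK];
    [definability|].
  destruct (open_union (fun O => sub O K)) as (R & HR & HRK); [definability|].
  assert (RK : sub R K) by (intros x (O & _ & HO & Hx)%HRK; auto).
  assert (VR : sub V R).
  { intros x Hx. apply HRK. exists V. repeat split; auto. intros y Hy. apply HK.
    split; [now apply (open_sub V)|]. intros C _ HC. now apply HC. }
  exists R, K. split; [exact HK|]. split; [exact HRK|]. split; [exact HR|].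
  split; [split; [now apply open_sub|]|split; [exact VR|]].
  (* From [V] contained in [R] and [R] in [K], the closure of [R] is again [K], so [R] is the
     interior of its own closure. *)
  - exists K. split; [|exact HRK]. intro x. rewrite HK. split.
    + intros [Hx H]. split; [exact Hx|]. intros C HC RC. apply H; [exact HC|].
      intros y Hy. now apply RC, VR.
    + intros [Hx H]. split; [exact Hx|]. intros C HC VC. apply H; [exact HC|].
      intros y [_ Hy]%RK%HK. now apply Hy.
  - intros O HO (x & HxO & Hx). apply (closure_meets K); [now apply open_sub|exact HK|exact HO|].
    exists x. auto.
Qed.

(** * From a locally finite sequence of open sets to a cellular family *)

Section Sequence.

(** [U n x]: the point [x] is in the [n]-th open set. *)
Variable U : M -> M -> Prop.
Hypothesis U_definable : definable (fun e => U (e 0) (e 1)).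
Hypothesis U_open : forall n, n ∈ omega -> exists O, O ∈ T /\ forall x, x ∈ O <-> U n x.
Hypothesis U_locally_bounded : forall x, x ∈ X -> exists N, N ∈ T /\ x ∈ N /\
  exists k, k ∈ omega /\ forall n, n ∈ omega -> (exists y, y ∈ N /\ U n y) -> n ∈ k.
Hypothesis U_unbounded : forall k, k ∈ omega ->
  exists n, n ∈ omega /\ ~ n ∈ k /\ exists x, U n x.

(** The points of [U n] outside the closure of the union of the later sets. *)
Definition exclusive (n x : M) : Prop :=
  U n x /\ exists O, O ∈ T /\ (forall m, m ∈ omega -> n ∈ m -> ~ exists y, y ∈ O /\ U m y) /\ x ∈ O.

Lemma exclusive_definable : definable (fun e => exclusive (e 0) (e 1)).
Proof. unfold exclusive. definability. Qed.

Lemma exclusive_open (n : M) :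
  n ∈ omega -> exists W, W ∈ T /\ forall x, x ∈ W <-> exclusive n x.
Proof.
  intro Hn. destruct (U_open n Hn) as (A & HA & KA).
  destruct (open_union (fun O => forall m, m ∈ omega -> n ∈ m -> ~ exists y, y ∈ O /\ U m y))
    as (B & HB & KB); [definability|].
  destruct (open_inter A B HA HB) as (W & HW & KW). exists W. split; [exact HW|].
  intro x. now rewrite KW, KA, KB.
Qed.

Lemma exclusive_disjoint (n m x : M) :
  n ∈ omega -> m ∈ omega -> exclusive n x -> exclusive m x -> n = m.
Proof.
  intros Hn Hm [Un (O & _ & KO & HO)] [Um (O' & _ & KO' & HO')].
  destruct (trichotomy n m Hn Hm) as [H|[H|H]]; auto; exfalso.
  - apply (KO m Hm H). eauto.
  - apply (KO' n Hn H). eauto.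
Qed.

Lemma exclusive_unbounded (k : M) :
  k ∈ omega -> exists n, n ∈ omega /\ k ∈ n /\ exists x, exclusive n x.
Proof.
  (* An index outside [succ k] is strictly greater than [k]. *)
  intro Hk. destruct (U_unbounded (succ k)) as (n & Hn & Hnk & x & Hx); [now apply succ_omega|].
  destruct (U_open n Hn) as (A & HA & KA). apply KA in Hx.
  destruct (U_locally_bounded x) as (N & HN & HxN & j & Hj & Kj); [now apply (open_sub A)|].
  destruct (open_inter A N HA HN) as (O & HO & KO).
  (* For the last [m] such that [O] meets [U m], the set [O] avoids all later members, so it
     witnesses that its points in [U m] are exclusive. Since [O] meets [U n], this [m] is at least
     [n]. *)
  destruct (greatest_exists (fun m => exists y, y ∈ O /\ U m y) j)
    as (m & Hm & (y & Hy & Uy) & G); [definability|exact Hj| | |].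
  - exists n. split; [exact Hn|]. exists x. rewrite KO. split; [auto|now apply KA].
  - intros i Hi (y & [_ Hy]%KO & Uy). apply Kj; eauto.
  - exists m. split; [exact Hm|]. split.
    + assert (Hnm : n ∈ m \/ n = m).
      { apply G; [exact Hn|]. exists x. rewrite KO. split; [auto|now apply KA]. }
      destruct (trichotomy k m Hk Hm) as [H|H]; [exact H|]. destruct Hnk. apply mem_succ.
      destruct Hnm as [Hnm| ->]; destruct H as [->|H]; auto.
      left. now apply (nat_trans k m).
    + exists y. split; [exact Uy|]. exists O. repeat split; auto.
      intros i Hi Hmi He. destruct (G i Hi He) as [H|H].
      * apply (mem_irrefl m). now apply (nat_trans m i).
      * subst. now apply (mem_irrefl m).
Qed.

(** [R] is the interior of the closure of the [n]-th exclusive set. A relation takes the place of a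
    function of [n], so that it is visibly definable. *)
Definition regularizes (n R : M) : Prop :=
  exists W K, (forall x, x ∈ W <-> exclusive n x) /\ is_closure X T K W /\ is_interior T R K.

Lemma regularizes_definable : definable (fun e => regularizes (e 0) (e 1)).
Proof. pose proof exclusive_definable. unfold regularizes. definability. Qed.

Lemma regularizes_functional (n R R' : M) : regularizes n R -> regularizes n R' -> R = R'.
Proof.
  intros (W & K & HW & HK & HR) (W' & K' & HW' & HK' & HR').
  assert (W = W') by (apply extensionality; intro; now rewrite HW, HW'). subst W'.
  assert (K = K') by (apply extensionality; intro; now rewrite (HK _), (HK' _)). subst K'.
  apply extensionality. intro. now rewrite (HR _), (HR' _).
Qed.

Lemma regularizes_exists (n : M) :
  n ∈ omega -> exists R, R ∈ T /\ regularizes n R.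
Proof.
  intro Hn. destruct (exclusive_open n Hn) as (W & HW & KW).
  destruct (regularization W HW) as (R & K & HK & HI & HR & _). exists R.
  split; [exact HR|]. exists W, K. auto.
Qed.

Lemma regularizes_spec (n R : M) :
  n ∈ omega -> regularizes n R ->
  regular_open X T R /\ (forall x, exclusive n x -> x ∈ R) /\
  (forall O, O ∈ T -> meets O R -> exists y, y ∈ O /\ exclusive n y).
Proof.
  intros Hn H. destruct (exclusive_open n Hn) as (W & HW & KW).
  destruct (regularization W HW) as (R' & K & HK & HI & HR & Hreg & HWR & HM).
  assert (R = R') as -> by (apply (regularizes_functional n); [exact H|exists W, K; auto]).
  split; [exact Hreg|]. split.
  - intros x Hx. now apply HWR, KW.
  - intros O HO HOR. destruct (HM O HO HOR) as (y & Hy & Hy'%KW). eauto.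
Qed.

(** Two passages from closure to set: the open [R] meets [S], hence the exclusive set of [m]; this
    is open and meets [R], hence the exclusive set of [n]. Exclusive sets with a common point have
    equal indices. *)
Lemma regularizes_disjoint (n m R S : M) :
  n ∈ omega -> m ∈ omega -> R ∈ T -> regularizes n R -> regularizes m S -> meets R S -> n = m.
Proof.
  intros Hn Hm HR Rn Sm HRS.
  destruct (regularizes_spec m S Hm Sm) as (_ & _ & KS).
  destruct (regularizes_spec n R Hn Rn) as (_ & _ & KR).
  destruct (KS R HR HRS) as (y & Hy & Vy).
  destruct (exclusive_open m Hm) as (W & HW & KW).
  destruct (KR W HW) as (z & Hz%KW & Vz).
  - exists y. split; [now apply KW|exact Hy].
  - now apply (exclusive_disjoint n m z).
Qed.

Lemma cellular_of_sequence :
  exists F, denumerable F /\ locally_finite X T F /\ cellular T F /\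
            forall R, R ∈ F -> regular_open X T R.
Proof.
  pose proof exclusive_definable as VD. pose proof regularizes_definable as RD.
  destruct (separate (fun n => exists x, exclusive n x) omega) as [B HB]; [definability|].
  destruct (separate (fun R => exists n, n ∈ B /\ regularizes n R) T) as [F HF]; [definability|].
  exists F. split; [|split; [|split]].
  - apply denumerable_iff, (equipotent_trans F B).
    + apply equipotent_sym, equipotent_iff. exists regularizes. split; [exact RD|]. split.
      * intros n Hn. pose proof Hn as [Ho _]%HB.
        destruct (regularizes_exists n Ho) as (R & HR & Rn).
        exists R. rewrite HF. eauto.
      * intros R [_ (n & Hn & Rn)]%HF. eauto.
      * intros n m R S [Hn Vn]%HB [Hm Vm]%HB [HR _]%HF [HS _]%HF Rn Sm. split; intros ->.
        -- now apply (regularizes_functional m).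
        (* Indices in [B] have non-empty exclusive sets, so a shared regularization meets itself and
           forces the indices to agree. *)
        -- apply (regularizes_disjoint n m S S); auto. destruct Vn as [x Vx].
           exists x. split; apply (regularizes_spec n S); auto.
    + apply denumerable_iff, unbounded_denumerable.
      * intros n Hn. now apply HB in Hn.
      * intros k Hk. destruct (exclusive_unbounded k Hk) as (n & Hn & Hkn & Vn).
        exists n. rewrite HB. auto.
  - split.
    + intros R [HR _]%HF. now apply open_sub.
    + intros x Hx. destruct (U_locally_bounded x Hx) as (N & HN & HxN & k & Hk & Kk).
      exists N. split.
      * split; [now apply open_sub|]. exists N. repeat split; auto. now intro.
      * destruct (separate (fun R => meets R N) F) as [G HG]; [definability|].
        exists G. split; [exact HG|].
        (* Members of [F] meeting the open [N] come from indices below [k]: their exclusive sets,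
           and so the sets [U n], meet [N] too. *)
        apply (finite_image regularizes k); [exact RD|now apply finite_nat|
          exact regularizes_functional|].
        intros R [[HR (n & Hn & Rn)]%HF (y & HyR & HyN)]%HG. apply HB in Hn as [Hn _].
        exists n. split; [|exact Rn]. apply Kk; [exact Hn|].
        destruct (regularizes_spec n R Hn Rn) as (_ & _ & KR).
        destruct (KR N HN) as (z & Hz & Vz); [now exists y|]. exists z. split; [exact Hz|apply Vz].
  - split; [|split].
    + intros R HR. now apply HF in HR.
    + intros R [_ (n & [Hn [x Vx]]%HB & Rn)]%HF He.
      apply (He x). now apply (regularizes_spec n R).
    + intros R S [HR (n & [Hn _]%HB & Rn)]%HF [HS (m & [Hm _]%HB & Sm)]%HF HRS K.
      assert (n = m) as -> by now apply (regularizes_disjoint n m R S).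
      apply HRS. now apply (regularizes_functional m).
  - intros R [_ (n & [Hn _]%HB & Rn)]%HF. now apply (regularizes_spec n R).
Qed.

End Sequence.

(** * The sequence of open sets supplied by IQDI *)

Lemma cellular_of_infinite (F : M) :
  iqdi M -> ~ finite F -> locally_finite X T F -> sub F T ->
  exists F', denumerable F' /\ locally_finite X T F' /\ cellular T F' /\
             forall R, R ∈ F' -> regular_open X T R.
Proof.
  intros Hiqdi Finf [_ Flf] FT.
  destruct (Hiqdi F Finf) as (S & HS & D & HD & HDen).
  pose proof HDen as (d & Hd & [d1 d2 d3])%denumerable_iff%equipotent_iff.
  (* With [s_i] the element of [D] matched with [i], [Q i A] says that [A] belongs to [s_i], and
     [rank A n] that [n] is the first such index. The [n]-th open set is the union of the members of
     rank [n]. *)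
  set (Q := fun i A => exists s, s ∈ D /\ i ∈ omega /\ d s i /\ A ∈ s).
  assert (HQ : definable (fun e => Q (e 0) (e 1))) by (unfold Q; definability).
  set (rank := fun A n => n ∈ omega /\ Q n A /\ forall i, i ∈ n -> ~ Q i A).
  assert (Hr : definable (fun e => rank (e 0) (e 1))) by (unfold rank; definability).
  assert (rank_unique : forall A n m, rank A n -> rank A m -> n = m).
  { intros A n m (Hn & Qn & Ln) (Hm & Qm & Lm).
    destruct (trichotomy n m Hn Hm) as [H|[H|H]]; auto; exfalso;
      [now apply (Lm n)|now apply (Ln m)]. }
  assert (rank_exists : forall A s, s ∈ D -> A ∈ s -> exists n, rank A n).
  { intros A s Hs HA. destruct (d1 s Hs) as (n & Hn & r).
    destruct (least_exists (fun n => Q n A) n) as (m & Hm); [definability|auto|now exists s|].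
    now exists m. }
  assert (Q_finite : forall i, i ∈ omega -> exists c, finite c /\ forall A, Q i A -> A ∈ c).
  { intros i Hi. destruct (d2 i Hi) as (s & Hs & r). exists s. split.
    - now apply HS, HD.
    - intros A (s' & Hs' & _ & r' & HA). replace s with s'; [exact HA|].
      now apply (d3 s' s i i). }
  apply (cellular_of_sequence (fun n x => exists A, A ∈ F /\ rank A n /\ x ∈ A)).
  - definability.
  - intros n Hn.
    destruct (open_union (fun A => A ∈ F /\ rank A n)) as (O & HO & KO); [definability|].
    exists O. split; [exact HO|]. intro x. rewrite KO. split.
    + intros (A & _ & [HA r] & Hx). eauto.
    + intros (A & HA & r & Hx). exists A. auto.
  - intros x Hx. destruct (Flf x Hx) as (N & [_ (O & HO & HxO & HON)] & G & HG & FG).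
    exists O. split; [exact HO|]. split; [exact HxO|].
    (* Ranks of the finitely many members meeting the neighborhood form a finite, hence bounded, set
       of numbers. *)
    destruct (separate (fun n => exists A, A ∈ G /\ rank A n) omega) as [b Hb]; [definability|].
    destruct (finite_bounded b) as (k & Hk & Kk).
    + apply (finite_image rank G); auto. intros n Hn. now apply Hb in Hn.
    + intros n Hn. now apply Hb in Hn.
    + exists k. split; [exact Hk|]. intros n Hn (y & Hy & A & HA & r & HyA).
      apply Kk, Hb. split; [exact Hn|]. exists A. split; [|exact r].
      apply HG. split; [exact HA|]. exists y. auto.
  - intros k Hk. apply NNPP. intro H.
    destruct (finite_bounded_union Q k HQ Q_finite Hk) as (c & Fc & Hc).
    apply (denumerable_infinite D HDen).
    (* If all sets from [k] on were empty, a member of some [s_i] would have rank below [k], and so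
       lie in [c], or be the empty set, which may belong to [F]. Then [D] would be part of a finite
       power set. *)
    apply (finite_sub (powerset (adj c empty))); [now apply finite_powerset, finite_adj|].
    intros s Hs. apply mem_powerset. intros A HA. apply mem_adj.
    destruct (rank_exists A s Hs HA) as [n r]. pose proof r as (Hn & Qn & _).
    destruct (classic (n ∈ k)) as [Hnk|Hnk]; [left; now apply (Hc n)|right].
    apply is_empty_eq. intros x Hx. apply H. exists n.
    split; [exact Hn|]. split; [exact Hnk|]. exists x, A. split; [|auto].
    apply HD, HS in Hs. now apply Hs.
Qed.

End Topology.

(** * The three assertions in a model, and the theorem *)

Lemma conclusion_zermelo_model (M : Set) {E : membership M} : zermelo_model M -> conclusion M.
Proof.
  intros Z Hiqdi.
  assert (K : forall X T F : M, topology X T -> ~ finite F -> locally_finite X T F -> sub F T ->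
    exists F', denumerable F' /\ locally_finite X T F' /\ cellular T F' /\
               forall R, R ∈ F' -> regular_open X T R).
  { intros X T F top. now apply cellular_of_infinite. }
  split; [|split].
  - intros X T top. split.
    + intros (F & HF & HL & HC). apply (K X T F top HF HL), HC.
    + intros (F & HF & HL & HC & _). exists F. split; [now apply denumerable_infinite|auto].
  - intros X T top (F & HF & HL & HT).
    destruct (K X T F top HF HL HT) as (F' & H). exists F'. tauto.
  - intros X T top HN. apply NNPP. intro H. apply HN. intros F HT HL.
    apply NNPP. intro HF. apply H. destruct (K X T F top HF HL HT) as (F' & K'). exists F'. tauto.
Qed.

Theorem theorem3p4 :
  ZF_proves (
    IQDI ⇒
    (* (i) *)
    (∀ X T, Topology X T ⇒
       ((∃ F, Infinite F ∧ LocallyFinite X T F ∧ Cellular T F) ⇔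
        (∃ F, Denumerable F ∧ LocallyFinite X T F ∧ Cellular T F ∧
              ∀ U, U ∈ F ⇒ RegularOpen X T U))) ∧
    (* (ii) *)
    (∀ X T, Topology X T ⇒
       (∃ F, Infinite F ∧ LocallyFinite X T F ∧ Sub F T) ⇒
       ∃ F, Denumerable F ∧ LocallyFinite X T F ∧ Cellular T F) ∧
    (* (iii) *)
    (∀ X T, Topology X T ⇒
       ¬ LightlyCompact X T ⇒
       ∃ F, Denumerable F ∧ LocallyFinite X T F ∧ Cellular T F))%fm.
Proof.
  apply completeness.
  - intros q []; try reflexivity; apply fv_bound_closure.
  - reflexivity.
  - intros M E HZ e.
    (* The value [e 0] shows that the model is inhabited and serves to build a constant valuation at
       which the axioms that are sentences are read. *)
    refine (proj2 (_ : _ <-> conclusion M) (conclusion_zermelo_model M (zermelo_model_of_sat M (e 0) HZ))).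
    unfold conclusion. read.
Qed.
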